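(* Let $\mathcal{H}$ be a hyperplane arrangement (with base chamber $T_0$) in an $n$-dimensional real inner product space $V$, and let $a\in V$ be such that the pizza quantity $P(\mathcal{H},\mathbb{B}(a,R))$ does not depend on the radius $R$ for $R\geq\|a\|$. Then for $R\geq\|a\|$, $$\sum_T(-1)^T\,\mathrm{Vol}_{n-1}\big(\partial(\mathbb{B}(a,R)\cap\overline{T})\big)=0,$$ where the sum is over all chambers $T$ of $\mathcal{H}$ and $\overline{T}$ denotes the closure of $T$.
   Context: $\mathbb{B}(a,R)=\{x\in V:\|x-a\|\leq R\}$. A hyperplane arrangement is a finite set of linear hyperplanes; chambers are connected components of the complement of their union; $(-1)^T=(-1)^s$ where $s$ is the number of hyperplanes separating $T$ from $T_0$; $P(\mathcal{H},K)=\sum_T(-1)^T\mathrm{Vol}(K\cap T)$. $\mathrm{Vol}_{n-1}(\partial X)$ denotes the $(n-1)$-dimensional surface volume of the boundary of the convex set $X$.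
   Formalization: The surface volume of a convex set with empty interior is counted twice (two-sided convention). This matters only for n = 1 and R = ‖a‖, where a piece can be {0}; with one-sided counting the claim fails there, e.g. for the arrangement {{0}} with a > 0 and R = a. *)

(* Defs.v *)
From HB Require Import structures.
From mathcomp Require Import all_boot all_order all_algebra.
From mathcomp Require Import all_classical all_reals all_analysis.
From mathcomp Require Import sesquilinear finmap.

Set Implicit Arguments.
Unset Strict Implicit.
Unset Printing Implicit Defensive.

Import Order.TTheory GRing.Theory Num.Theory.
Import numFieldNormedType.Exports.

Local Open Scope classical_set_scope.
Local Open Scope ring_scope.

(* Lebesgue measure on R^n, as the n-fold product of the one on R. The product
   with R^0, a single point, starts from the Dirac mass. *)
Fixpoint lebesgue_tuple (R : realType) (n : nat) :
    set (n.-tuple R) -> \bar R :=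
  match n with
  | 0 => fun A => \d_([tuple] : 0.-tuple R) A
  | m.+1 => fun A =>
      (@lebesgue_measure R \x @lebesgue_tuple R m)%E
        [set p : R * m.-tuple R | A [tuple of p.1 :: p.2]]
  end.

Definition unit_ball_volume (R : realType) (d : nat) : \bar R :=
  lebesgue_tuple [set x : d.-tuple R | \sum_(i < d) tnth x i ^+ 2 <= 1].

Section Hausdorff.
Context {R : realType} {V : normedModType R}.
Implicit Types (A U X : set V) (d : nat).
Local Open Scope ereal_scope.

(* The diameter of the empty set is -oo. *)
Definition diameter U : \bar R :=
  ereal_sup [set `|p.1 - p.2|%:E | p in U `*` U].

(* The empty set has weight 0 also for d = 0, where 0 ^+ 0 = 1 makes the weight
   of a point 1. *)
Definition hausdorff_weight d U : \bar R :=
  if `[< U = set0 >] then 0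
  else unit_ball_volume R d * (diameter U * (2^-1)%:E) ^+ d.

Definition hausdorff_content d (delta : R) A : \bar R :=
  ereal_inf [set \sum_(0 <= k <oo) hausdorff_weight d (U k) | U in
    [set U : (set V)^nat |
      (forall k, diameter (U k) <= delta%:E) /\ A `<=` \bigcup_k U k]].

(* d-dimensional Hausdorff (outer) measure of the metric space V, normalised to
   agree with Lebesgue measure on d-dimensional Euclidean subspaces. *)
Definition hausdorff d A : \bar R :=
  ereal_sup [set hausdorff_content d delta A | delta in
    [set delta : R | (0 < delta)%R]].

Definition boundary X : set V := closure X `\` X°.

(* Surface volume Vol_(n-1) (boundary X) of a convex set X in dimension n. As
   usual for convex sets, one with empty interior is two-sided: it counts twice,
   so that the surface volume is the derivative at 0 of the volume of the
   eps-neighbourhood of X, or twice the intrinsic volume of degree n - 1. In the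
   sets B(a,R) `&` closure T below, an empty interior forces the set to be a
   single point, so this matters only for n = 1. For n = 0 the boundary is
   empty. *)
Definition surface_volume n X : \bar R :=
  (if `[< X° = set0 >] then 2%:E else 1) * hausdorff n.-1 (boundary X).

End Hausdorff.

Section Arrangement.
Context {R : realType} {V : normedModType R}.
Variable dot : {dot V for (@idfun R)}.
Implicit Types (Hs : set (set V)) (H T K : set V).

Definition orthonormal_basis n (e : 'I_n -> V) : Prop :=
  (forall i j, dot (e i) (e j) = (i == j)%:R) /\
  (forall x, exists c : 'I_n -> R, x = \sum_i c i *: e i).

(* Lebesgue measure of V, through the coordinates in an orthonormal basis. *)
Definition volume n (e : 'I_n -> V) (A : set V) : \bar R :=
  lebesgue_tuple [set x : n.-tuple R | A (\sum_i tnth x i *: e i)].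

Definition hyperplane (u : V) : set V := [set x | dot u x = 0].

Definition arrangement Hs : Prop :=
  finite_set Hs /\ forall H, Hs H -> exists2 u, u != 0 & H = hyperplane u.

Definition arrangement_complement Hs : set V := ~` \bigcup_(H in Hs) H.

Definition chambers Hs : set (set V) :=
  [set connected_component (arrangement_complement Hs) x
    | x in arrangement_complement Hs].

Definition separates H T (T0 : set V) : Prop :=
  exists u, [/\ H = hyperplane u,
    T `<=` [set x | 0 < dot u x] & T0 `<=` [set x | dot u x < 0]].

Definition chamber_sign Hs (T0 : set V) T : R :=
  (-1) ^+ #|` fset_set [set H | Hs H /\ separates H T T0]|%fset.

Definition pizza Hs (T0 : set V) n (e : 'I_n -> V) K : \bar R :=
  (\sum_(T \in chambers Hs) (chamber_sign Hs T0 T)%:E * volume e (K `&` T))%E.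

Definition disk (a : V) (r : R) : set V := [set x | `|x - a| <= r].

End Arrangement.

(* Main.v *)
(** Every chamber is a cell, given by the signs of the linear forms defining the
    hyperplanes. The surface of a piece of the ball consists of a part of the
    sphere and of facets. The facets cancel in the alternating sum, since each one
    is shared by two cells of opposite signs.

    For the spherical part it suffices that the union P of the even cells and the
    union M of the odd ones cut sets of the same area out of the sphere. Let
    K(x, y) be the indicator of |y - (x pushed outwards by 2 rho)| <= rho, for x
    on the sphere, and integrate K over the pairs with x in P. Integrating in y
    first gives the area of P on the sphere times the volume of a ball. On the
    other hand, since x and y are at distance at most 3 rho, up to an error near
    the hyperplanes this is the integral over the pairs with y in P. Integrating
    in x first, one gets a radial function of y supported in |y - a| > r (areas
    are invariant under reflections), and the integrals of such a function over
    P and M agree because the shells of P and M have the same volume. The error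
    tends to 0 with rho since hyperplanes meet the sphere in null sets when
    n >= 2. The half lines of n = 1 are treated by hand. *)

Require Import Defs.
From HB Require Import structures.
From mathcomp Require Import finmap.
From mathcomp Require Import all_boot all_order all_algebra.
From mathcomp Require Import all_classical all_reals all_analysis.
From mathcomp Require Import sesquilinear measurable_realfun.
From mathcomp Require Import ring lra.

Set Implicit Arguments.
Unset Strict Implicit.
Unset Printing Implicit Defensive.

Import Order.TTheory GRing.Theory Num.Theory.
Import numFieldNormedType.Exports.

Local Open Scope classical_set_scope.
Local Open Scope ring_scope.

(** * Hausdorff measures *)

Section hausdorff_outer_measure.
Context {R : realType} {V : normedModType R}.
Implicit Types (A B U : set V) (d : nat).
Local Open Scope ereal_scope.

(** The obstacle is that areas are Hausdorff measures while the hypothesis speaks of Lebesgue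
    volumes. Differentiating the volume in the radius would call for polar coordinates, hence for
    the exact relation between the two measures. The double count with K avoids computing any such
    constant: the area enters only through its finiteness on the sphere, its additivity on Borel
    sets and its invariance under isometries. The push goes outwards because the volumes are
    controlled only for radii at least [|a|], and r may equal [|a|]. A ball of radius rho centred at
    distance r + 2 rho from a lies between the radii r + rho and r + 3 rho, hence in the controlled
    range. The count yields an inequality between the areas of P and M with an error term;
    exchanging P and M gives the equality. Additivity of the area comes from Caratheodory's
    criterion for metric outer measures. The same coordinate grids that bound Hausdorff measures
    from above provide all finiteness and all null sets: a set on which m coordinates control the
    others in a Lipschitz way has finite m-measure and vanishing (m+1)-measure. *)

Lemma lebesgue_tuple_ge0 n (A : set (n.-tuple R)) : 0 <= lebesgue_tuple A.
Proof.
elim: n A => [|n IHn] A /=; first by rewrite diracE.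
by apply: integral_ge0 => x _; exact: IHn.
Qed.

Lemma diameter0 : diameter (set0 : set V) = -oo.
Proof. by rewrite /diameter set0X image_set0 ereal_sup0. Qed.

Lemma diameter_ge0 U : U !=set0 -> 0 <= diameter U.
Proof.
move=> [x Ux]; apply: ereal_sup_ubound; exists (x, x) => //=.
by rewrite subrr normr0.
Qed.

Lemma le_diameter U (c : R) :
  (forall x y, U x -> U y -> (`|x - y| <= c)%R) -> diameter U <= c%:E.
Proof.
move=> Uc; apply: ge_ereal_sup => _ [[x y] [/= Ux Uy] <-].
by rewrite lee_fin; exact: Uc.
Qed.

Lemma diameter_ge U x y : U x -> U y -> `|x - y|%:E <= diameter U.
Proof. by move=> Ux Uy; apply: ereal_sup_ubound; exists (x, y). Qed.

Lemma hausdorff_weight0 d : hausdorff_weight d (set0 : set V) = 0.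
Proof. by rewrite /hausdorff_weight asboolT. Qed.

Lemma hausdorff_weight_ge0 d U : 0 <= hausdorff_weight d U.
Proof.
rewrite /hausdorff_weight; case: asboolP => // /eqP/set0P U0.
rewrite mule_ge0 ?lebesgue_tuple_ge0// expe_ge0//.
by rewrite mule_ge0 ?diameter_ge0.
Qed.

(** [mu_ext] admits only covers by measurable sets. The discrete sigma-algebra on a copy of [V]
    admits every cover, as the Hausdorff content does. *)
Let discrete := V.
HB.instance Definition _ := Pointed.on discrete.
HB.instance Definition _ := @isMeasurable.Build default_measure_display
  discrete discrete_measurable discrete_measurable0
  discrete_measurableC discrete_measurableU.

(** An infinite weight above diameter [delta] moves the restriction on covers into the weight, so
    that the content becomes the outer measure generated by a set function. *)
Definition capped_weight d (delta : R) U : \bar R :=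
  if `[< diameter U <= delta%:E >] then hausdorff_weight d U else +oo.

Lemma capped_weight0 d delta : capped_weight d delta set0 = 0.
Proof.
by rewrite /capped_weight diameter0 asboolT ?leNye// hausdorff_weight0.
Qed.

Lemma capped_weight_ge0 d delta U : 0 <= capped_weight d delta U.
Proof. by rewrite /capped_weight; case: ifP; rewrite ?hausdorff_weight_ge0. Qed.

Lemma hausdorff_contentE d delta :
  hausdorff_content d delta = mu_ext (capped_weight d delta : set discrete -> _).
Proof.
apply/funext => A; apply/eqP; rewrite eq_le; apply/andP; split.
- apply: le_ereal_inf_tmp => _ [U [_ AU] <-].
  have [Ud|/existsNP[k Uk]] := pselect (forall k, diameter (U k) <= delta%:E).
    apply: ereal_inf_lbound; exists U => //.
    by apply: eq_eseriesr => k _; rewrite /capped_weight asboolT.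
  rewrite (@eseries_pinfty _ _ xpredT k) ?leey//.
    by move=> n _; rewrite -ltNye (lt_le_trans _ (capped_weight_ge0 _ _ _)).
  by rewrite /capped_weight asboolF.
- apply: le_ereal_inf_tmp => _ [U [Ud AU] <-].
  apply: ereal_inf_lbound; exists U => //.
  by apply: eq_eseriesr => k _; rewrite /capped_weight asboolT.
Qed.

Lemma hausdorff_content_ge0 d delta A : 0 <= hausdorff_content d delta A.
Proof. by rewrite hausdorff_contentE mu_ext_ge0//; exact: capped_weight_ge0. Qed.

Lemma le_hausdorff d delta A : (0 < delta)%R ->
  hausdorff_content d delta A <= hausdorff d A.
Proof. by move=> d0; apply: ereal_sup_ubound; exists delta. Qed.

Let hausdorff_set0 d : hausdorff d (set0 : set V) = 0.
Proof.
apply/eqP; rewrite eq_le; apply/andP; split; last first.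
  exact: le_trans (hausdorff_content_ge0 d 1 set0) (le_hausdorff _ _ ltr01).
apply: ge_ereal_sup => _ [delta _ <-].
rewrite hausdorff_contentE mu_ext0//; first exact: capped_weight0.
exact: capped_weight_ge0.
Qed.

Let hausdorff_ge0 d A : 0 <= hausdorff d A.
Proof. exact: le_trans (hausdorff_content_ge0 d 1 A) (le_hausdorff _ _ ltr01). Qed.

Let hausdorff_homo d : {homo @hausdorff R V d : A B / A `<=` B >-> A <= B}.
Proof.
move=> A B AB; apply: ge_ereal_sup => _ [delta delta0 <-].
apply: le_trans (le_hausdorff d B delta0).
by rewrite !hausdorff_contentE; exact: le_mu_ext.
Qed.

Let hausdorff_sigma_subadditive d : sigma_subadditive (@hausdorff R V d).
Proof.
move=> F; apply: ge_ereal_sup => _ [delta delta0 <-].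
have := @mu_ext_sigma_subadditive _ discrete R (capped_weight d delta)
  (@capped_weight_ge0 d delta) F.
rewrite -hausdorff_contentE => /le_trans; apply.
apply: lee_nneseries => n _; first by rewrite hausdorff_content_ge0.
exact: le_hausdorff.
Qed.

HB.instance Definition _ d := isOuterMeasure.Build R V
  (@hausdorff R V d)
  (hausdorff_set0 d) (@hausdorff_ge0 d) (@hausdorff_homo d)
  (@hausdorff_sigma_subadditive d).

End hausdorff_outer_measure.

(** * Hausdorff measure as a metric outer measure *)

Section hausdorff_metric_outer_measure.
Context {R : realType} {V : normedModType R}.
Implicit Types (A B U X : set V) (d : nat) (f : V -> R).
Local Open Scope ereal_scope.

Lemma lee_expe (x y : \bar R) d : 0 <= x -> x <= y -> x ^+ d <= y ^+ d.
Proof.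
move=> x0 xy; elim: d => [|d IHd]; first by rewrite !expe0.
by rewrite !expeS lee_pmul// expe_ge0.
Qed.

Lemma le_hausdorff_weight d U B : (U = set0 -> B = set0) ->
  diameter B <= diameter U -> hausdorff_weight d B <= hausdorff_weight d U.
Proof.
move=> UB BU; rewrite {1}/hausdorff_weight.
case: asboolP => [_|/eqP/set0P B0]; first exact: hausdorff_weight_ge0.
rewrite /hausdorff_weight asboolF; last by move=> /UB B0'; move: B0; rewrite B0' => -[].
rewrite lee_wpmul2l ?lebesgue_tuple_ge0// lee_expe ?lee_wpmul2r//.
by rewrite mule_ge0 ?diameter_ge0.
Qed.

(** A contraction turns a cover into a cover by sets of no larger diameter. This serves for
    reflections and, with constant maps, to compare points. *)
Lemma hausdorff_contract d (g : V -> V) A :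
  (forall x y, `|g x - g y| <= `|x - y|)%R ->
  hausdorff d (g @` A) <= hausdorff d A.
Proof.
move=> gc; apply: ge_ereal_sup => _ [delta delta0 <-].
apply: le_trans (le_hausdorff d A delta0).
apply: le_ereal_inf_tmp => _ [U [Ud AU] <-].
have dU k : diameter (g @` U k) <= diameter (U k).
  apply: ge_ereal_sup => _ [[_ _] [[x Ux <-] [y Uy <-]] <-] /=.
  by apply: le_trans (diameter_ge Ux Uy); rewrite lee_fin.
apply: (@le_trans _ _ (\sum_(0 <= k <oo) hausdorff_weight d (g @` U k))).
  apply: ereal_inf_lbound; exists (fun k => g @` U k) => //; split.
    by move=> k; exact: le_trans (dU k) (Ud k).
  by move=> _ [x /AU [k _ Ux] <-]; exists k => //; exists x.
apply: lee_nneseries => k _; first by move=> _; exact: hausdorff_weight_ge0.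
by apply: le_hausdorff_weight => // ->; rewrite image_set0.
Qed.

(** A set of diameter at most [delta < e] cannot meet both [A] and [B]. Hence a cover of the union
    splits into two covers, each padded by empty sets, which weigh 0. *)
Lemma hausdorff_content_sep d (delta e : R) A B : (delta < e)%R ->
  (forall x y, A x -> B y -> (e <= `|x - y|)%R) ->
  hausdorff_content d delta A + hausdorff_content d delta B <=
  hausdorff_content d delta (A `|` B).
Proof.
move=> de sepAB; apply: le_ereal_inf_tmp => _ [U [Ud ABU] <-].
pose W C k := if `[< U k `&` C = set0 >] then set0 else U k.
have WC C : C `<=` A `|` B -> hausdorff_content d delta C <=
    \sum_(0 <= k <oo) hausdorff_weight d (W C k).
  move=> CAB; apply: ereal_inf_lbound; exists (W C) => //; split.
    by move=> k; rewrite /W; case: ifP => //; rewrite diameter0 leNye.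
  move=> x Cx; have /ABU [k _ Ukx] := CAB _ Cx; exists k => //.
  rewrite /W asboolF// => /seteqP[/(_ x) + _]; exact.
apply: (le_trans (leeD (WC A (@subsetUl _ _ _)) (WC B (@subsetUr _ _ _)))).
rewrite -nneseriesD; last 2 first.
- by move=> k _ _; exact: hausdorff_weight_ge0.
- by move=> k _ _; exact: hausdorff_weight_ge0.
apply: lee_nneseries => k _.
  by move=> _; rewrite adde_ge0// hausdorff_weight_ge0.
rewrite /W; case: asboolP => [_|/eqP/set0P[x [Ux Ax]]].
  by rewrite hausdorff_weight0 add0e; case: ifP; rewrite ?hausdorff_weight0 ?hausdorff_weight_ge0.
case: asboolP => [_|/eqP/set0P[y [Uy By]]]; first by rewrite hausdorff_weight0 adde0.
have := le_trans (diameter_ge Ux Uy) (Ud k).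
by rewrite lee_fin leNgt (lt_le_trans de (sepAB _ _ Ax By)).
Qed.

Lemma le_hausdorff_content d (delta delta' : R) A : (delta <= delta')%R ->
  hausdorff_content d delta' A <= hausdorff_content d delta A.
Proof.
move=> dd; apply: ereal_inf_le_tmp => _ [U [Ud AU] <-]; exists U => //; split => //.
by move=> k; rewrite (le_trans (Ud k))// lee_fin.
Qed.

(** The contents add up at small scales. The two suprema over scales are then taken one after the
    other, by subtractions that make sense once all values are finite. *)
Lemma hausdorffU_sep d (e : R) A B : (0 < e)%R ->
  (forall x y, A x -> B y -> (e <= `|x - y|)%R) ->
  hausdorff d A + hausdorff d B <= hausdorff d (A `|` B).
Proof.
move=> e0 sepAB; have [->|] := eqVneq (hausdorff d (A `|` B)) +oo.
  by rewrite leey.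
rewrite -ltey => ABfin.
have finC C : C `<=` A `|` B -> hausdorff d C \is a fin_num.
  move=> CAB; rewrite ge0_fin_numE ?outer_measure_ge0//.
  exact: le_lt_trans (le_outer_measure (hausdorff d) _ _ CAB) ABfin.
have finA := finC A (@subsetUl _ _ _); have finB := finC B (@subsetUr _ _ _).
rewrite -leeBrDr//.
apply: ge_ereal_sup => _ [d1 d10 <-].
have fin1 : hausdorff_content d d1 A \is a fin_num.
  rewrite ge0_fin_numE ?hausdorff_content_ge0//.
  apply: le_lt_trans (le_hausdorff d A d10) _.
  by rewrite -ge0_fin_numE ?outer_measure_ge0.
rewrite leeBrDr//.
rewrite addeC -leeBrDr//.
apply: ge_ereal_sup => _ [d2 d20 <-].
rewrite leeBrDr// addeC.
(* A scale finer than both given ones and smaller than the gap [e]. *)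
pose delta := Num.min (Num.min d1 d2) (e / 2)%R.
have delta0 : (0 < delta)%R by rewrite !lt_min d10 d20 divr_gt0.
have deltae : (delta < e)%R by rewrite gt_min ltr_pdivrMr// ltr_pMr// ltr1n orbT.
apply: le_trans (le_hausdorff d (A `|` B) delta0).
apply: le_trans (hausdorff_content_sep d deltae sepAB).
by apply: leeD; apply: le_hausdorff_content; rewrite !ge_min lexx ?orbT.
Qed.

Lemma hausdorffU_level d f (b c : R) A B :
  (forall x y, `|f x - f y| <= `|x - y|)%R -> (c < b)%R ->
  (forall x, A x -> b <= f x)%R -> (forall x, B x -> f x <= c)%R ->
  hausdorff d A + hausdorff d B <= hausdorff d (A `|` B).
Proof.
move=> f1 cb Ab Bc; apply: (@hausdorffU_sep _ (b - c)%R); first by rewrite subr_gt0.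
move=> x y /Ab bx /Bc yc; apply: le_trans (f1 x y).
by apply: le_trans (ler_norm _); rewrite lerB.
Qed.

(* Caratheodory's criterion. Only the layers [a (k+1) <= f < a k], a k =
   1/(k+1), are lost between {f <= 0} and {f > 0}; layers of the same parity are
   at positive distance, so that the sum of their measures is finite. *)
Lemma hausdorff_sublevel_caratheodory d f :
  (forall x y, `|f x - f y| <= `|x - y|)%R ->
  (@hausdorff R V d).-caratheodory [set x | (f x <= 0)%R].
Proof.
move=> f1; apply: le_caratheodory_measurable => X /=.
set F := [set x | (f x <= 0)%R].
have [->|] := eqVneq (hausdorff d X) +oo; first by rewrite leey.
rewrite -ltey => Xfin.
have HX C : C `<=` X -> hausdorff d C <= hausdorff d X.
  exact: le_outer_measure.
pose a k : R := (k.+1%:R^-1)%R.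
have a_lt i j : (i < j)%N -> (a j < a i)%R.
  by move=> ij; rewrite /a ltf_pV2 ?posrE// ltr_nat.
pose L k := X `&` [set x | (a k.+2 <= f x < a k.+1)%R].
have parity p m : \sum_(j < m) hausdorff d (L (2 * j + p)%N) <=
    hausdorff d (X `&` [set x | (a (2 * m + p)%N <= f x)%R]).
  elim: m => [|m IHm]; first by rewrite !big_ord0 outer_measure_ge0.
  rewrite !big_ord_recr/=; apply: (le_trans (leeD IHm (lexx _))).
  apply: (@le_trans _ _ (hausdorff d ((X `&`
      [set x | (a (2 * m + p)%N <= f x)%R]) `|` L (2 * m + p)%N))).
    apply: (@hausdorffU_level _ f (a (2 * m + p)%N) (a (2 * m + p).+1)) => //.
    - exact: a_lt.
    - by move=> x [].
    - by move=> x [_ /andP[_ /ltW]].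
  apply: le_outer_measure => x [[Xx /= ax]|[Xx /= /andP[ax _]]]; split => //=.
    by rewrite (le_trans _ ax)// ltW// a_lt// ltn_add2r ltn_pmul2l.
  by rewrite (_ : _ + p = (2 * m + p).+2)%N// mulnS.
have total n : \sum_(0 <= i < n) hausdorff d (L i) <=
    hausdorff d X + hausdorff d X.
  apply: (@le_trans _ _ (\sum_(0 <= i < 2 * n) hausdorff d (L i))).
    apply: lee_sum_nneg_natr => //; last by rewrite leq_pmull.
    by move=> i _ _; exact: outer_measure_ge0.
  apply: (@le_trans _ _ (\sum_(j < n) hausdorff d (L (2 * j + 0)%N) +
      \sum_(j < n) hausdorff d (L (2 * j + 1)%N))); last first.
    by apply: leeD; apply: le_trans (parity _ _) _; exact: HX.
  rewrite -big_split/= big_mkord; elim: {parity} n => [|n IHn].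
    by rewrite muln0 !big_ord0.
  by rewrite mulnS !big_ord_recr/= addn0 addn1 addeA; do 2 apply: leeD => //.
have tail : (\sum_(k <= i <oo) hausdorff d (L i)) @[k --> \oo] --> 0.
  apply: nneseries_tail_cvg; last by move=> *; exact: outer_measure_ge0.
  apply: (@le_lt_trans _ _ (hausdorff d X + hausdorff d X)).
    apply: lime_le.
      by apply: is_cvg_nneseries => *; exact: outer_measure_ge0.
    by apply: nearW => n; exact: total.
  by rewrite lte_add_pinfty.
have {}tail : (hausdorff d X + \sum_(k <= i <oo) hausdorff d (L i)) @[k --> \oo]
    --> hausdorff d X.
  rewrite -[X in _ --> X]adde0; apply: cvgeD => //; last exact: cvg_cst.
  by rewrite fin_num_adde_defl.
have := cvg_lim (@ereal_hausdorff R) tail; move=> <-.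
apply: lime_ge; first by apply/cvg_ex; exists (hausdorff d X).
apply: nearW => k.
apply: (@le_trans _ _ (hausdorff d (X `&` F) +
  (hausdorff d (X `&` [set x | (a k.+1 <= f x)%R]) +
   \sum_(k <= i <oo) hausdorff d (L i)))).
  apply: leeD => //.
  apply: (@le_trans _ _ (hausdorff d (X `&` [set x | (a k.+1 <= f x)%R]) +
    hausdorff d (\bigcup_(i in ~` `I_k) L i))); last first.
    by apply: leeD => //; exact: outer_measure_sigma_subadditive_tail.
  apply: le_trans (outer_measureU2 _ _ _); apply: le_outer_measure.
  move=> x [Xx /negP]; rewrite -ltNge => fx0.
  have [ax|xa] := leP (a k.+1) (f x); first by left.
  have exa : exists m, (a m <= f x)%R.
    exists (Num.truncn (f x)^-1%R).
    rewrite /a invf_ple ?posrE// ltW//; exact: truncnS_gt.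
  (* The least such [m] satisfies [a m <= f x < a m.-1]. It is at least 2, and writing it as [m.+2]
     shows that [x] lies in the layer [L m]. *)
  case: (ex_minnP exa) => m am minm; right.
  have km : (k.+1 < m)%N.
    have := le_lt_trans am xa.
    by rewrite /a ltf_pV2 ?posrE// ltr_nat ltnS.
  case: m am minm km => [//|[//|m]] am minm km; exists m.
    by apply/negP; rewrite -leqNgt.
  split => //=; rewrite am/= ltNge; apply/negP => /minm.
  by rewrite ltnn.
rewrite addeA; apply: leeD => //; rewrite addeC.
apply: le_trans (@hausdorffU_level _ f (a k.+1) 0%R _ _ _ _ _ _) _ => //.
- by rewrite invr_gt0.
- by move=> x [].
- by move=> x [].
- by apply: HX => x [[]|[]].
Qed.

End hausdorff_metric_outer_measure.

(** * Lebesgue measure on tuples *)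

Section lebesgue_tuple_measure.
Context {R : realType}.
Local Open Scope ereal_scope.

Definition tuple_cons n (p : measurableTypeR R * n.-tuple R) : n.+1.-tuple R :=
  [tuple of p.1 :: p.2].

Lemma measurable_tuple_cons n : measurable_fun setT (@tuple_cons n).
Proof.
apply: (@measurable_cons _ _ _ _ (fst : measurableTypeR R * n.-tuple R -> R) n
  (snd : measurableTypeR R * n.-tuple R -> n.-tuple R)).
  exact: (@measurable_fst _ _ (measurableTypeR R) (n.-tuple R)).
exact: measurable_snd.
Qed.

HB.instance Definition _ n := @isMeasurableFun.Build _ _ _ _
  (@tuple_cons n) (@measurable_tuple_cons n).

Definition tuple_uncons n (x : n.+1.-tuple R) : measurableTypeR R * n.-tuple R :=
  (thead x, [tuple of behead x]).

Lemma tuple_consK n : cancel (@tuple_cons n) (@tuple_uncons n).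
Proof.
by move=> [x y]; congr pair; apply/val_inj.
Qed.

Lemma measurable_tuple_uncons n : measurable_fun setT (@tuple_uncons n).
Proof.
apply: measurable_fun_pair; last exact: measurable_behead.
exact: (measurable_tnth ord0).
Qed.

Lemma preimage_tuple_cons_measurable n (A : set (n.+1.-tuple R)) :
  measurable A -> measurable (@tuple_cons n @^-1` A).
Proof.
by move=> mA; rewrite -[X in measurable X]setTI; exact: measurable_tuple_cons.
Qed.

Lemma preimage_tuple_uncons_measurable n (A : set (measurableTypeR R * n.-tuple R)) :
  measurable A -> measurable (@tuple_uncons n @^-1` A).
Proof.
by move=> mA; rewrite -[X in measurable X]setTI; exact: measurable_tuple_uncons.
Qed.

Let lebesgue_tuple0 n : @lebesgue_tuple R n set0 = 0.
Proof.
elim: n => [|n IHn] /=; first by rewrite dirac0.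
rewrite /product_measure1 integral0_eq// => x _ /=.
by rewrite -[RHS]IHn; congr lebesgue_tuple; apply/seteqP; split => // y; rewrite /xsection/= inE.
Qed.

(** Additivity and sigma-finiteness share one induction: the product with the line is known to be a
    measure only once the factor of dimension n is sigma-finite. *)
Let lebesgue_tuple_sigma_finite_measure n :
  semi_sigma_additive (@lebesgue_tuple R n) /\
  sigma_finite setT (@lebesgue_tuple R n).
Proof.
elim: n => [|n [add sfin]].
  split; first exact: measure_semi_sigma_additive.
  exact: (sigma_finiteT (\d_([tuple] : 0.-tuple R))).
pose isM := isMeasure.Build _ _ _ (@lebesgue_tuple R n)
  (lebesgue_tuple0 n) (@lebesgue_tuple_ge0 R n) add.
pose m0 : {measure set _ -> \bar R} := HB.pack (@lebesgue_tuple R n) isM.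
pose isS := Measure_isSigmaFinite.Build _ _ _ (Measure.sort m0) sfin.
pose m : {sigma_finite_measure set _ -> \bar R} :=
  HB.pack (Measure.sort m0) isS.
pose lm : {measure set (measurableTypeR R * n.-tuple R)%type -> \bar R} :=
  (@lebesgue_measure R \x m).
have lmE A : @lebesgue_tuple R n.+1 A = lm (@tuple_cons n @^-1` A) by [].
split.
  move=> F mF tF mUF; rewrite lmE preimage_bigcup.
  apply: measure_semi_sigma_additive.
  - by move=> k; exact: preimage_tuple_cons_measurable.
  - apply/trivIsetP => /= i j _ _ ij; rewrite -preimage_setI.
    by move/trivIsetP : tF => /(_ _ _ _ _ ij) ->//; rewrite preimage_set0.
  - by rewrite -preimage_bigcup; exact: preimage_tuple_cons_measurable.
have /sigma_finiteP[F [FT ndF Foo]] := sigma_finiteT (@lebesgue_measure R).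
have /sigma_finiteP[G [GT ndG Goo]] := sigma_finiteT m.
(* Both exhausting sequences are nondecreasing, so their products, taken at equal indices, already
   exhaust the space. *)
exists (fun k => @tuple_uncons n @^-1` (F k `*` G k)).
  rewrite -preimage_bigcup; apply/seteqP; split => // x _.
  have : (\bigcup_k F k) (tuple_uncons x).1 by rewrite -FT.
  have : (\bigcup_k G k) (tuple_uncons x).2 by rewrite -GT.
  move=> [j _ Gj] [i _ Fi]; exists (maxn i j) => //; split.
    by move: Fi; exact/subsetPset/ndF/leq_maxl.
  by move: Gj; exact/subsetPset/ndG/leq_maxr.
move=> k; have [mF Fk] := Foo k; have [mG Gk] := Goo k; split.
  by apply: preimage_tuple_uncons_measurable; exact: measurableX.
rewrite lmE -comp_preimage (_ : _ \o _ = id) ?preimage_id; last first.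
  by apply/funext => p /=; rewrite tuple_consK.
have -> : lm (F k `*` G k) = lebesgue_measure (F k) * m (G k).
  exact: product_measure1E.
by rewrite lte_mul_pinfty// ge0_fin_numE.
Qed.

HB.instance Definition _ n := isMeasure.Build _ _ _ (@lebesgue_tuple R n)
  (lebesgue_tuple0 n) (@lebesgue_tuple_ge0 R n)
  (lebesgue_tuple_sigma_finite_measure n).1.

HB.instance Definition _ n := Measure_isSigmaFinite.Build _ _ _
  (@lebesgue_tuple R n) (lebesgue_tuple_sigma_finite_measure n).2.

Lemma lebesgue_tupleS n (A : set (n.+1.-tuple R)) :
  lebesgue_tuple A = \int[lebesgue_measure]_x
    lebesgue_tuple (xsection (@tuple_cons n @^-1` A) x).
Proof. by []. Qed.

End lebesgue_tuple_measure.

(** * Translations, cubes and balls *)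

Section lebesgue_tuple_theory.
Context {R : realType}.
Local Open Scope ereal_scope.

(** The pushforward of Lebesgue measure by a shift has the right value on half-open intervals, hence
    is Lebesgue measure by uniqueness. *)
Lemma lebesgue_integral_shift (c : R) (g : R -> \bar R) :
  measurable_fun setT g -> (forall x, 0 <= g x) ->
  \int[lebesgue_measure]_x g (x + c)%R = \int[lebesgue_measure]_x g x.
Proof.
move=> mg g0; pose s : measurableTypeR R -> measurableTypeR R := fun x => (x + c)%R.
have ms : measurable_fun setT s by exact: measurable_funD.
rewrite -[LHS]/(\int[lebesgue_measure]_(x in s @^-1` setT) (g \o s) x).
rewrite -(ge0_integral_pushforward ms)//.
apply: eq_measure_integral => A mA _ /=; apply/esym.
apply: (lebesgue_measure_unique (mu := measure_function_pushforward__canonical__measure_function_Measure _ ms)) => // _ [[a b] _ <-] /=.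
rewrite /pushforward.
have -> : s @^-1` `]a, b]%classic = `](a - c)%R, (b - c)%R]%classic.
  by apply/seteqP; split => x /=; rewrite !in_itv/= ltrBlDr lerBrDr.
rewrite !lebesgue_measure_itv/= !lte_fin ltrD2r; case: ifP => // _.
by rewrite -!EFinB; congr EFin; ring.
Qed.

Definition add_tuple n (x c : n.-tuple R) : n.-tuple R :=
  [tuple (tnth x i + tnth c i)%R | i < n].

Lemma tuple_cons_add n x (y : n.-tuple R) (c : n.+1.-tuple R) :
  add_tuple (tuple_cons (x, y)) c =
  tuple_cons ((x + thead c)%R, add_tuple y [tuple of behead c]).
Proof.
apply: eq_from_tnth => i; rewrite tnth_mktuple.
have [j ->|->] := unliftP ord0 i; rewrite /tuple_cons.
  rewrite !tnthS tnth_mktuple (tnth_behead c); congr (_ + tnth c _)%R.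
  by apply/val_inj; rewrite /= inordK// ltnS.
by rewrite !tnth0.
Qed.

Lemma lebesgue_tuple_shift n (c : n.-tuple R) (A : set (n.-tuple R)) :
  measurable A ->
  lebesgue_tuple [set x | A (add_tuple x c)] = lebesgue_tuple A.
Proof.
elim: n c A => [|n IHn] c A mA.
  congr lebesgue_tuple; apply/seteqP; split=> x /=; rewrite [x]tuple0 [add_tuple _ _]tuple0//.
have mcA := preimage_tuple_cons_measurable mA.
rewrite !lebesgue_tupleS -[RHS](lebesgue_integral_shift (thead c)).
- apply: eq_integral => x _.
  rewrite -[RHS](IHn [tuple of behead c]); last exact: measurable_xsection.
  congr lebesgue_tuple; apply/seteqP; split => y; rewrite /xsection/= !inE/= tuple_cons_add//.
- exact: (@measurable_fun_xsection _ _ _ _ R (@lebesgue_tuple R n) _ mcA).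
- by move=> x; exact: lebesgue_tuple_ge0.
Qed.

Lemma measurable_tuple_box n (t : R) :
  measurable [set x : n.-tuple R | forall i, (`|tnth x i| <= t)%R].
Proof.
rewrite (_ : [set _ | _] = \bigcap_(i in [set: 'I_n])
    [set x : n.-tuple R | (`|tnth x i| <= t)%R]); last first.
  by apply/seteqP; split => [x xt i _|x xt i]; exact: xt.
apply: fin_bigcap_measurable => // i _.
rewrite -[X in measurable X]setTI; apply: measurable_fun_le => //.
by apply: measurableT_comp => //; exact: measurable_tnth.
Qed.

Lemma lebesgue_tuple_box n (t : R) : (0 <= t)%R ->
  lebesgue_tuple [set x : n.-tuple R | forall i, (`|tnth x i| <= t)%R] =
  ((2 * t) ^+ n)%:E.
Proof.
move=> t0; elim: n => [|n IHn].
  by rewrite /= diracE mem_set// => -[].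
rewrite lebesgue_tupleS.
rewrite (_ : (fun x => _) = (fun x => ((2 * t) ^+ n)%:E * (\1_`[(-t)%R, t] x)%:E)).
  rewrite ge0_integralZl//=.
  - rewrite integral_indic//= setIT lebesgue_measure_itv/= lte_fin.
    case: ifPn => [_|]; first by rewrite -EFinB -EFinM exprS; congr EFin; ring.
    rewrite -leNgt => t0'; rewrite mule0 (_ : t = 0%R) ?mulr0 ?expr0n//.
    by apply/eqP; rewrite eq_le t0 andbT; lra.
  - by apply/measurable_EFinP; exact: measurable_indic.
  - by rewrite lee_fin exprn_ge0// mulr_ge0.
apply/funext => x; rewrite indicE mem_setE in_itv/= -ler_norml.
have [xt|xt] := boolP (`|x| <= t)%R; last first.
  rewrite mule0 -(@measure0 _ _ _ (@lebesgue_tuple R n)); congr lebesgue_tuple.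
  apply/seteqP; split => // y; rewrite /xsection/= inE/= => /(_ ord0).
  by rewrite /tuple_cons tnth0/= (negbTE xt).
rewrite mule1 -IHn; congr lebesgue_tuple; apply/seteqP; split => y.
  rewrite /xsection/= inE/= => yt i; have := yt (lift ord0 i).
  by rewrite /tuple_cons tnthS.
rewrite /xsection/= inE/= => yt i; have [j ->|->] := unliftP ord0 i.
  by rewrite /tuple_cons tnthS; exact: yt.
by rewrite /tuple_cons tnth0.
Qed.

Definition tuple_ball n (c : n.-tuple R) (rho : R) : set (n.-tuple R) :=
  [set x | (\sum_(i < n) (tnth x i - tnth c i) ^+ 2 <= rho ^+ 2)%R].

Lemma measurable_tuple_poly n (c : n.-tuple R) :
  measurable_fun setT
    (fun x : n.-tuple R => \sum_(i < n) (tnth x i - tnth c i) ^+ 2)%R.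
Proof.
apply: measurable_sum => i; apply: measurable_funX; apply: measurable_funB => //.
exact: measurable_tnth.
Qed.

Lemma measurable_tuple_ball n (c : n.-tuple R) rho : measurable (tuple_ball c rho).
Proof.
rewrite -[X in measurable X]setTI; apply: measurable_fun_le => //.
exact: measurable_tuple_poly.
Qed.

Lemma lebesgue_tuple_ballE n (c c' : n.-tuple R) rho :
  lebesgue_tuple (tuple_ball c rho) = lebesgue_tuple (tuple_ball c' rho).
Proof.
rewrite -(lebesgue_tuple_shift [tuple (tnth c i - tnth c' i)%R | i < n]); last first.
  exact: measurable_tuple_ball.
congr lebesgue_tuple; apply/funext => x; rewrite /tuple_ball/=.
congr (is_true (_ <= _)%R); apply: eq_bigr => i _.
by rewrite !tnth_mktuple; congr (_ ^+ 2)%R; ring.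
Qed.

Lemma tuple_ball_sub_box n rho : (0 <= rho)%R ->
  tuple_ball [tuple 0%R | i < n] rho `<=` [set x | forall i, (`|tnth x i| <= rho)%R].
Proof.
move=> rho0 x xr i; rewrite -(ler_pXn2r (_ : 0 < 2)%N) ?nnegrE//.
rewrite real_normK ?num_real//; apply: le_trans xr.
rewrite (bigD1 i)//= tnth_mktuple subr0 lerDl sumr_ge0// => j _.
by rewrite sqr_ge0.
Qed.

Lemma lebesgue_tuple_ball_lty n (c : n.-tuple R) rho : (0 <= rho)%R ->
  lebesgue_tuple (tuple_ball c rho) < +oo.
Proof.
move=> rho0; rewrite (lebesgue_tuple_ballE _ [tuple 0%R | i < n]).
apply: (@le_lt_trans _ _ (lebesgue_tuple
    [set x : n.-tuple R | forall i, (`|tnth x i| <= rho)%R])).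
  apply: le_measure; rewrite ?inE//; [exact: measurable_tuple_ball|exact: measurable_tuple_box|].
  exact: tuple_ball_sub_box.
by rewrite lebesgue_tuple_box// ltry.
Qed.

Lemma lebesgue_tuple_ball_gt0 n (c : n.-tuple R) rho : (0 < rho)%R ->
  0 < lebesgue_tuple (tuple_ball c rho).
Proof.
move=> rho0; rewrite (lebesgue_tuple_ballE _ [tuple 0%R | i < n]).
(* The cube of half side [t] lies in the ball since [n * t ^+ 2 <= rho ^+ 2]; the successor also
   covers [n = 0]. *)
pose t := (rho / n.+1%:R)%R.
have t0 : (0 < t)%R by rewrite divr_gt0.
apply: (@lt_le_trans _ _ (lebesgue_tuple
    [set x : n.-tuple R | forall i, (`|tnth x i| <= t)%R])).
  by rewrite lebesgue_tuple_box ?ltW// lte_fin exprn_gt0// mulr_gt0.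
apply: le_measure; rewrite ?inE; [exact: measurable_tuple_box|exact: measurable_tuple_ball|].
move=> x xt; rewrite /tuple_ball/=.
apply: (@le_trans _ _ (\sum_(i < n) t ^+ 2)%R).
  apply: ler_sum => i _; rewrite tnth_mktuple subr0 -real_normK ?num_real//.
  by rewrite ler_pXn2r ?nnegrE ?(ltW t0)//; exact: xt.
rewrite sumr_const card_ord /t expr_div_n -[X in (X <= _)%R]mulr_natr -mulrA.
rewrite ler_piMr ?sqr_ge0// mulrC ler_pdivrMr ?exprn_gt0// mul1r.
by rewrite -natrX ler_nat expnS expn1 (leq_trans (leqnSn n))// leq_pmulr.
Qed.

Lemma unit_ball_volume_lty n : unit_ball_volume R n < +oo.
Proof.
have := lebesgue_tuple_ball_lty [tuple 0%R | i < n] ler01.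
congr (lebesgue_tuple _ < +oo); apply/funext => x /=.
rewrite /tuple_ball/= expr1n; congr (is_true (_ <= _)%R); apply: eq_bigr => i _.
by rewrite tnth_mktuple subr0.
Qed.

End lebesgue_tuple_theory.

Arguments lebesgue_tuple : simpl never.

(** * Euclidean spaces *)

Section hausdorff_covering.
Context {R : realType} {V : normedModType R}.
Implicit Types (A : set V) (d m : nat).
Local Open Scope ereal_scope.

Lemma unit_ball_volume_fin_num d : unit_ball_volume R d \is a fin_num.
Proof. by rewrite ge0_fin_numE ?unit_ball_volume_lty// lebesgue_tuple_ge0. Qed.

Lemma hausdorff_weight_le d (c : R) (U : set V) : (0 <= c)%R ->
  diameter U <= c%:E ->
  hausdorff_weight d U <= (fine (unit_ball_volume R d) * (c / 2) ^+ d)%:E.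
Proof.
move=> c0 Uc; rewrite /hausdorff_weight; case: asboolP => [_|/eqP/set0P U0].
  rewrite lee_fin mulr_ge0 ?fine_ge0 ?lebesgue_tuple_ge0//.
  by rewrite exprn_ge0// divr_ge0.
rewrite EFinM fineK ?unit_ball_volume_fin_num// lee_wpmul2l ?lebesgue_tuple_ge0//.
rewrite EFin_expe lee_expe//; first by rewrite mule_ge0 ?diameter_ge0.
by rewrite EFinM lee_wpmul2r.
Qed.

Lemma hausdorff_content_finite_cover d (T : finType) (delta c : R) A
    (U : T -> set V) : (0 <= c <= delta)%R ->
  A `<=` \bigcup_t U t -> (forall t, diameter (U t) <= c%:E) ->
  hausdorff_content d delta A <=
  (#|T|%:R * (fine (unit_ball_volume R d) * (c / 2) ^+ d))%:E.
Proof.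
move=> /andP[c0 cd] AU Uc.
(* The finite family becomes a sequence by appending empty sets, which weigh 0. *)
pose F k := nth set0 [seq U t | t <- enum T] k.
have Fc k : diameter (F k) <= c%:E.
  have [kT|Tk] := ltnP k (size (enum T)).
    rewrite /F; case: (enum T) kT => [//|t0 s] ks.
    by rewrite (nth_map t0)//.
  by rewrite /F nth_default ?size_map -?enumT// diameter0 leNye.
apply: (@le_trans _ _ (\sum_(0 <= k <oo) hausdorff_weight d (F k))).
  apply: ereal_inf_lbound; exists F => //; split.
    by move=> k; rewrite (le_trans (Fc k))// lee_fin.
  move=> x /AU[t _ Utx]; exists (index t (enum T)) => //.
  by rewrite /F (nth_map t) ?index_mem ?mem_enum// nth_index ?mem_enum.
rewrite (nneseries_split _ #|T|); last by move=> *; exact: hausdorff_weight_ge0.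
rewrite add0n [X in _ + X]eseries0 ?adde0; last first.
  move=> k Tk _; rewrite /F nth_default ?hausdorff_weight0//.
  by rewrite size_map -cardE.
apply: (@le_trans _ _ (\sum_(0 <= k < #|T|)
    (fine (unit_ball_volume R d) * (c / 2) ^+ d)%:E)).
  by apply: lee_sum => k _; exact: hausdorff_weight_le.
by rewrite big_mkord sumEFin sumr_const card_ord mulr_natl.
Qed.

(* Covering by the preimages of the cubes of side 1 / (N + 1). *)
Lemma hausdorff_content_coord m d (A : set V) (g : V -> 'I_m -> R) (K N : nat)
    (C delta : R) : (0 <= C)%R ->
  (forall x i, A x -> `|g x i| <= K%:R)%R ->
  (forall x y (eta : R), (0 <= eta)%R -> A x -> A y -> (forall i, `|g x i - g y i| <= eta)%R ->
    (`|x - y| <= C * eta)%R) ->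
  (C / N.+1%:R <= delta)%R ->
  hausdorff_content d delta A <=
  (((2 * K).+1 * N.+1)%:R ^+ m *
   (fine (unit_ball_volume R d) * (C / N.+1%:R / 2) ^+ d))%:E.
Proof.
move=> C0 gK gC Cdelta.
pose T := {ffun 'I_m -> 'I_((2 * K).+1 * N.+1)}.
(* The index of the grid interval containing the i-th coordinate, shifted by [K] to be nonnegative.
   The shifted coordinate is at most [2 * K], and this value can be attained, whence the
   [(2 * K).+1 * N.+1] possible indices. *)
pose q x i := Num.truncn (N.+1%:R * (g x i + K%:R)).
pose U (t : T) := A `&` [set x | forall i, q x i = t i].
have gK0 x i : A x -> (0 <= g x i + K%:R)%R.
  by move=> /gK => /(_ i); rewrite ler_norml => /andP[]; rewrite -subr_ge0 opprK.
have := @hausdorff_content_finite_cover d T delta (C / N.+1%:R)%R A U.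
rewrite card_ffun !card_ord natrX; apply.
- by rewrite divr_ge0.
- move=> x Ax.
  have qlt i : (q x i < (2 * K).+1 * N.+1)%N.
    rewrite truncn_lt_nat ?mulr_ge0 ?gK0//.
    have := gK x i Ax; rewrite ler_norml => /andP[_ gxK].
    rewrite mulnC natrM ltr_pM2l ?ltr0n// (le_lt_trans (lerD gxK (lexx _)))//.
    by rewrite -natrD ltr_nat addnn mul2n.
  exists [ffun i => Ordinal (qlt i)] => //; split => // i.
  by rewrite ffunE.
- move=> t; apply: le_diameter => x y [Ax /= xt] [Ay /= yt].
  apply: gC => // i.
  have xi := truncn_itv (mulr_ge0 (ler0n R N.+1) (gK0 x i Ax)).
  have yi := truncn_itv (mulr_ge0 (ler0n R N.+1) (gK0 y i Ay)).
  move: xi yi; rewrite -/(q x i) -/(q y i) xt yt.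
  move: (nat_of_ord (t i)) => k /andP[xk kx] /andP[yk ky].
  rewrite -(ler_pM2l (ltr0Sn R N)) mulfV// -[X in (X * _)%R]normr_nat -normrM.
  by rewrite ler_norml; apply/andP; split; lra.
Qed.

(** The number of grid cells grows like the m-th power of [N.+1] while each weighs its inverse up to
    a constant, so the bound does not depend on the scale. *)
Lemma hausdorff_coord_lty m (A : set V) (g : V -> 'I_m -> R) (K : nat) (C : R) :
  (0 <= C)%R ->
  (forall x i, A x -> `|g x i| <= K%:R)%R ->
  (forall x y (eta : R), (0 <= eta)%R -> A x -> A y -> (forall i, `|g x i - g y i| <= eta)%R ->
    (`|x - y| <= C * eta)%R) ->
  hausdorff m A < +oo.
Proof.
move=> C0 gK gC; pose c := fine (unit_ball_volume R m).
apply: (@le_lt_trans _ _ (((2 * K).+1%:R ^+ m * (c * (C / 2) ^+ m))%:E)); last first.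
  exact: ltry.
apply: ge_ereal_sup => _ [delta delta0 <-].
pose N := Num.truncn (C / delta).
apply: le_trans (@hausdorff_content_coord m m A g K N C delta C0 gK gC _) _.
  rewrite ler_pdivrMr// mulrC -ler_pdivrMr//; apply/ltW; exact: truncnS_gt.
rewrite lee_fin -/c natrM (exprMn _ (2 * K).+1%:R).
have -> : ((C / N.+1%:R / 2) ^+ m = (C / 2) ^+ m * (N.+1%:R ^+ m)^-1)%R.
  by rewrite mulrAC expr_div_n.
rewrite le_eqVlt; apply/orP; left; apply/eqP; field.
by rewrite expf_neq0.
Qed.

(** With one dimension more in the weight than there are coordinates, the same count decays like
    [b / N.+1]. *)
Lemma hausdorff_coord0 m (A : set V) (g : V -> 'I_m -> R) (K : nat) (C : R) :
  (0 <= C)%R ->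
  (forall x i, A x -> `|g x i| <= K%:R)%R ->
  (forall x y (eta : R), (0 <= eta)%R -> A x -> A y -> (forall i, `|g x i - g y i| <= eta)%R ->
    (`|x - y| <= C * eta)%R) ->
  hausdorff m.+1 A = 0.
Proof.
move=> C0 gK gC; pose c := fine (unit_ball_volume R m.+1).
have c0 : (0 <= c)%R by rewrite fine_ge0// lebesgue_tuple_ge0.
pose b := ((2 * K).+1%:R ^+ m * (c * (C / 2) ^+ m.+1))%R.
have b0 : (0 <= b)%R by rewrite !mulr_ge0 ?exprn_ge0// divr_ge0.
apply/eqP; rewrite eq_le outer_measure_ge0 andbT.
apply: ge_ereal_sup => _ [delta delta0 <-].
apply/lee_addgt0Pr => e e0; rewrite add0e.
(* Fine enough for the diameters to be at most [delta] and for the total weight to be at most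
   [e]. *)
pose N := Num.truncn (C / delta + b / e).
have NS : (C / delta + b / e < N.+1%:R)%R by exact: truncnS_gt.
apply: le_trans (@hausdorff_content_coord m m.+1 A g K N C delta C0 gK gC _) _.
  rewrite ler_pdivrMr// mulrC -ler_pdivrMr//; apply/ltW/(le_lt_trans _ NS).
  by rewrite lerDl divr_ge0// ltW.
rewrite lee_fin -/c natrM (exprMn _ (2 * K).+1%:R).
have -> : ((C / N.+1%:R / 2) ^+ m.+1 = (C / 2) ^+ m.+1 * (N.+1%:R ^+ m.+1)^-1)%R.
  by rewrite mulrAC expr_div_n.
rewrite (_ : (_ * _)%R = (b / N.+1%:R)%R); last first.
  rewrite /b (exprS N.+1%:R); field.
  by rewrite expf_neq0// andbT addrC natr1.
rewrite ler_pdivrMr// mulrC -ler_pdivrMr//; apply/ltW/(le_lt_trans _ NS).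
by rewrite lerDr divr_ge0// ltW.
Qed.

Lemma hausdorff_set1_lty (x : V) : hausdorff 0 [set x] < +oo.
Proof.
apply: (@hausdorff_coord_lty 0 _ (fun _ _ => 0%R) 0 0) => //; first by move=> *; rewrite normr0.
by move=> _ _ eta _ -> -> _; rewrite subrr normr0 mul0r.
Qed.

Lemma hausdorff_set1 m (x : V) : hausdorff m.+1 [set x] = 0.
Proof.
apply: (@hausdorff_coord0 m _ (fun _ _ => 0%R) 0 0) => //; first by move=> *; rewrite normr0.
by move=> _ _ eta _ -> -> _; rewrite subrr normr0 mul0r.
Qed.

End hausdorff_covering.

(** * Inner products, reflections and orthonormal coordinates *)

Section euclidean.
Context {R : realType} {V : normedModType R} (dot : {dot V for (@idfun R)}).
Hypothesis norm_dot : forall x : V, `|x| ^+ 2 = dot x x.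
Implicit Types (x y z u w a : V) (A : set V).

Lemma dotC x y : dot x y = dot y x.
Proof. by rewrite hermC/= expr0 mul1r. Qed.

Lemma dotDr x : {morph dot x : y z / y + z}. Proof. exact: linearDr. Qed.
Lemma dotBr x : {morph dot x : y z / y - z}. Proof. exact: linearBr. Qed.
Lemma dotNr x : {morph dot x : y / - y}. Proof. exact: linearNr. Qed.
Lemma dot0r x : dot x 0 = 0. Proof. exact: linear0r. Qed.
Lemma dotZr x (c : R) y : dot x (c *: y) = c * dot x y.
Proof. by rewrite linearZr_LR. Qed.

Lemma dotDl y x z : dot (x + z) y = dot x y + dot z y.
Proof. by rewrite !(dotC _ y) dotDr. Qed.
Lemma dotBl y x z : dot (x - z) y = dot x y - dot z y.
Proof. by rewrite !(dotC _ y) dotBr. Qed.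
Lemma dotNl x y : dot (- x) y = - dot x y.
Proof. by rewrite !(dotC _ y) dotNr. Qed.
Lemma dotZl (c : R) x y : dot (c *: x) y = c * dot x y.
Proof. by rewrite !(dotC _ y) dotZr. Qed.
Lemma dot_sumr x (I : Type) (r : seq I) (P : pred I) (F : I -> V) :
  dot x (\sum_(i <- r | P i) F i) = \sum_(i <- r | P i) dot x (F i).
Proof. exact: linear_sumr. Qed.

Lemma dotxx_eq0 x : (dot x x == 0) = (x == 0).
Proof. by rewrite -norm_dot sqrf_eq0 normr_eq0. Qed.

Lemma dotxx_gt0 x : x != 0 -> 0 < dot x x.
Proof. by move=> x0; rewrite -norm_dot exprn_gt0// normr_gt0. Qed.

Lemma cauchy_schwarz x y : `|dot x y| <= `|x| * `|y|.
Proof.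
have [->|y0] := eqVneq y 0; first by rewrite dot0r !normr0 mulr0.
have yy := dotxx_gt0 y0.
have : 0 <= dot (x - (dot x y / dot y y) *: y) (x - (dot x y / dot y y) *: y).
  by rewrite -norm_dot sqr_ge0.
rewrite dotBl !dotBr dotZl !dotZr dotZl (dotC y x).
rewrite (_ : _ - _ - _ = (dot x x * dot y y - dot x y ^+ 2) / dot y y); last first.
  by field; rewrite gt_eqF.
rewrite pmulr_lge0 ?invr_gt0// subr_ge0 -!norm_dot -exprMn -real_normK ?num_real//.
by rewrite ler_pXn2r// nnegrE mulr_ge0.
Qed.

Lemma eq_norm_dot x y : (`|x| == `|y|) = (dot x x == dot y y).
Proof. by rewrite -!norm_dot eqrXn2. Qed.

(** The reflection in the hyperplane orthogonal to [w]. For [w = 0] it is the identity, so that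
    [reflect_swap] includes the case of equal points. *)
Definition reflect w x := x - (2 * dot w x / dot w w) *: w.

Lemma dot_reflect w x y : dot (reflect w x) (reflect w y) = dot x y.
Proof.
rewrite /reflect; have [->|w0] := eqVneq w 0; first by rewrite !scaler0 !subr0.
rewrite dotBl !dotBr !dotZl !dotZr (dotC x w); field.
by rewrite dotxx_eq0.
Qed.

Lemma reflectK w : involutive (reflect w).
Proof.
move=> x; rewrite /reflect; have [->|w0] := eqVneq w 0; first by rewrite !scaler0 !subr0.
rewrite dotBr dotZr -addrA -opprD -scalerDl.
set c : R := _ + _; rewrite (_ : c = 0) ?scale0r ?subr0//.
by rewrite /c; field; rewrite dotxx_eq0.
Qed.

Lemma reflectB w x y : reflect w (x - y) = reflect w x - reflect w y.
Proof.
by rewrite /reflect dotBr mulrBr mulrBl scalerBl !opprD !opprK addrACA.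
Qed.

Lemma norm_reflect w x : `|reflect w x| = `|x|.
Proof. by apply/eqP; rewrite eq_norm_dot dot_reflect. Qed.

(** For equal norms, [dot (x - y) (x - y)] is twice [dot (x - y) x], so the reflection subtracts
    exactly [x - y]. *)
Lemma reflect_swap x y : `|x| = `|y| -> reflect (x - y) x = y.
Proof.
move=> /eqP; rewrite eq_norm_dot => /eqP xy.
have [xy0|xy0] := eqVneq (x - y) 0.
  by rewrite /reflect xy0 scaler0 subr0; apply/eqP; rewrite -subr_eq0 xy0.
set p := dot (x - y) x.
have dd : dot (x - y) (x - y) = 2 * p.
  by rewrite /p dotBr !dotBl -xy (dotC y x); ring.
have p0 : p != 0 by apply: contraNneq xy0 => p0; rewrite -dotxx_eq0 dd p0 mulr0.
by rewrite /reflect -/p dd divff ?scale1r ?subKr// mulf_neq0// pnatr_eq0.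
Qed.

Definition reflect_at a w x := a + reflect w (x - a).

Lemma reflect_atK a w : involutive (reflect_at a w).
Proof.
by move=> x; rewrite /reflect_at (addrC a (reflect w (x - a))) addrK reflectK addrC subrK.
Qed.

Lemma norm_reflect_at a w x : `|reflect_at a w x - a| = `|x - a|.
Proof. by rewrite /reflect_at addrC addKr norm_reflect. Qed.

Lemma reflect_at_isometry a w x y :
  `|reflect_at a w x - reflect_at a w y| = `|x - y|.
Proof.
rewrite /reflect_at opprD addrACA subrr add0r -reflectB norm_reflect.
by rewrite opprB addrA subrK.
Qed.

Lemma hausdorff_reflect_at d a w A :
  hausdorff d [set x | A (reflect_at a w x)] = hausdorff d A.
Proof.
have le B : (hausdorff d [set x | B (reflect_at a w x)] <= hausdorff d B)%E.
  rewrite (_ : [set _ | _] = reflect_at a w @` B).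
    by apply: hausdorff_contract => x y; rewrite reflect_at_isometry.
  apply/seteqP; split => [x Bx|_ [x Bx <-]] /=; last by rewrite reflect_atK.
  by exists (reflect_at a w x); rewrite ?reflect_atK.
apply/eqP; rewrite eq_le le/=.
apply: le_trans (le [set x | A (reflect_at a w x)]).
by rewrite (_ : [set _ | _] = A)//; apply/funext => x /=; rewrite reflect_atK.
Qed.

Section coordinates.
Context (n : nat) (e : 'I_n -> V).
Hypothesis e_basis : orthonormal_basis dot e.

Definition coord x : n.-tuple R := [tuple dot (e i) x | i < n].
Definition vec (t : n.-tuple R) : V := \sum_i tnth t i *: e i.

Lemma dot_basis i j : dot (e i) (e j) = (i == j)%:R.
Proof. by case: e_basis. Qed.

Lemma dot_basis_sum i (c : 'I_n -> R) : dot (e i) (\sum_j c j *: e j) = c i.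
Proof.
rewrite dot_sumr (bigD1 i)//= big1 ?addr0.
  by rewrite dotZr dot_basis eqxx mulr1.
by move=> j ji; rewrite dotZr dot_basis eq_sym (negbTE ji) mulr0.
Qed.

Lemma vecK : cancel vec coord.
Proof.
move=> t; apply: eq_from_tnth => i; rewrite tnth_mktuple; exact: dot_basis_sum.
Qed.

Lemma basis_expand x : x = \sum_i dot (e i) x *: e i.
Proof.
have [_ /(_ x)[c xc]] := e_basis; rewrite {1}xc; apply: eq_bigr => i _.
by rewrite xc dot_basis_sum.
Qed.

Lemma coordK : cancel coord vec.
Proof.
move=> x; rewrite [RHS]basis_expand; apply: eq_bigr => i _.
by rewrite tnth_mktuple.
Qed.

Lemma dot_expand x y : dot x y = \sum_i dot (e i) x * dot (e i) y.
Proof.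
rewrite {1}(basis_expand y) dot_sumr; apply: eq_bigr => i _.
by rewrite dotZr mulrC (dotC x).
Qed.

Lemma norm_expand x : `|x| ^+ 2 = \sum_i dot (e i) x ^+ 2.
Proof. by rewrite norm_dot dot_expand. Qed.

Lemma norm_basis i : `|e i| = 1.
Proof.
by apply/eqP; rewrite -(@eqrXn2 _ 2)// norm_dot dot_basis eqxx expr1n.
Qed.

Lemma coord_le_norm i x : `|dot (e i) x| <= `|x|.
Proof. by apply: le_trans (cauchy_schwarz _ _) _; rewrite norm_basis mul1r. Qed.

Lemma norm_le_coord x : `|x| <= \sum_i `|dot (e i) x|.
Proof.
rewrite {1}(basis_expand x); apply: le_trans (ler_norm_sum _ _ _) _.
by apply: ler_sum => i _; rewrite normrZ norm_basis mulr1.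
Qed.

End coordinates.
End euclidean.

(** * Sets on which a few coordinates control the others *)

Section euclidean_null_sets.
Context {R : realType} {V : normedModType R} (dot : {dot V for (@idfun R)}).
Hypothesis norm_dot : forall x : V, `|x| ^+ 2 = dot x x.
Implicit Types (x y z u w a : V) (A : set V).

Lemma sub_bigsetU (T : finType) (F : T -> set V) :
  \bigcup_t F t `<=` \big[setU/set0]_t F t.
Proof. by move=> x [t _ Ft]; rewrite (bigD1 t)//=; left. Qed.

Lemma hausdorff_bigcup_lty (T : finType) d (F : T -> set V) A :
  A `<=` \bigcup_t F t -> (forall t, hausdorff d (F t) < +oo)%E ->
  (hausdorff d A < +oo)%E.
Proof.
move=> /subset_trans/(_ (@sub_bigsetU _ _)) AF Ffin.
apply: le_lt_trans (le_outer_measure (hausdorff d) _ _ AF) _ => {A AF}.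
elim/big_ind : _ => [|A B Aoo Boo|t _]; first by rewrite outer_measure0.
  by apply: le_lt_trans (outer_measureU2 (hausdorff d) _ _) _; rewrite lte_add_pinfty.
exact: Ffin.
Qed.

Lemma hausdorff_bigcup0 (T : finType) d (F : T -> set V) A :
  A `<=` \bigcup_t F t -> (forall t, hausdorff d (F t) = 0)%E ->
  hausdorff d A = 0%E.
Proof.
move=> /subset_trans/(_ (@sub_bigsetU _ _)) AF F0.
apply/eqP; rewrite eq_le outer_measure_ge0 andbT.
apply: le_trans (le_outer_measure (hausdorff d) _ _ AF) _ => {A AF}.
elim/big_ind : _ => [|A B A0 B0|t _]; first by rewrite outer_measure0.
  by apply: le_trans (outer_measureU2 (hausdorff d) _ _) _; rewrite adde_le0.
by rewrite /= F0.
Qed.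

Section coordinates.
Context (n : nat) (e : 'I_n -> V).
Hypothesis e_basis : orthonormal_basis dot e.
Let c i x := dot (e i) x.

(** In other words, [A] is a Lipschitz graph over the [m] coordinates selected by [iota]. *)
Definition coord_determined m (A : set V) (iota : 'I_m -> 'I_n) :=
  exists2 D : R, 0 <= D & forall x y (eta : R), 0 <= eta -> A x -> A y ->
    (forall k, `|c (iota k) (x - y)| <= eta) ->
    forall i, `|c i (x - y)| <= D * eta.

Definition norm_bounded A := exists M : R, forall x, A x -> `|x| <= M.

Lemma hausdorff_determined m A (iota : 'I_m -> 'I_n) : norm_bounded A ->
  coord_determined A iota -> (hausdorff m A < +oo /\ hausdorff m.+1 A = 0)%E.
Proof.
move=> [M AM] [D D0 AD].
pose K := (Num.truncn M).+1.
have gK x k : A x -> `|c (iota k) x| <= K%:R.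
  move=> /AM xM; apply: le_trans (coord_le_norm norm_dot e_basis _ _) _.
  exact: le_trans xM (ltW (truncnS_gt _)).
have gC x y eta : 0 <= eta -> A x -> A y ->
    (forall k, `|c (iota k) x - c (iota k) y| <= eta) ->
    `|x - y| <= n%:R * D * eta.
  move=> eta0 Ax Ay xy; apply: le_trans (norm_le_coord norm_dot e_basis _) _.
  apply: (@le_trans _ _ (\sum_(i < n) D * eta)).
    by apply: ler_sum => i _; apply: AD => // k; rewrite /c dotBr; exact: xy.
  by rewrite sumr_const card_ord -mulrA mulr_natl.
have C0 : 0 <= n%:R * D by rewrite mulr_ge0.
split.
- exact: (@hausdorff_coord_lty _ _ m A (fun x k => c (iota k) x) K _ C0).
- exact: (@hausdorff_coord0 _ _ m A (fun x k => c (iota k) x) K _ C0).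
Qed.

Lemma norm_bounded_sub A (B : set V) : A `<=` B -> norm_bounded B -> norm_bounded A.
Proof. by move=> AB [M BM]; exists M => x /AB; exact: BM. Qed.

Lemma norm_bounded_disk a r : norm_bounded (disk a r).
Proof.
exists (r + `|a|) => x xa; rewrite -(subrK a x).
by apply: le_trans (ler_normD _ _) _; rewrite lerD2r.
Qed.

Lemma dot_sub_eq0 u x y k : dot u x = k -> dot u y = k -> dot u (x - y) = 0.
Proof. by rewrite dotBr => -> ->; rewrite subrr. Qed.

Lemma neq0_coord u : u != 0 -> exists i, c i u != 0.
Proof.
move=> u0; apply/existsP; apply: contraNT u0; rewrite negb_exists => /forallP u0.
rewrite (basis_expand e_basis u) big1// => i _.
by have := u0 i; rewrite negbK /c => /eqP ->; rewrite scale0r.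
Qed.

(** If all entries were below [s / #|T|.+1%:R], their squares would sum to less than [s ^+ 2]; the
    successor makes this strict. *)
Lemma exists_large_coord (T : finType) (P : pred T) (z : T -> R) (s : R) :
  0 < s -> s ^+ 2 <= \sum_(i | P i) z i ^+ 2 ->
  exists2 i, P i & s / #|T|.+1%:R <= `|z i|.
Proof.
move=> s0 sz; apply/exists_inP; apply: contraLR sz.
rewrite negb_exists => /forallP zs; rewrite -ltNge.
apply: (@le_lt_trans _ _ (\sum_(i : T) (s / #|T|.+1%:R) ^+ 2)).
  rewrite big_mkcond; apply: ler_sum => i _; case: ifPn => Pi; last exact: sqr_ge0.
  have := zs i; rewrite Pi/= -ltNge => /ltW zi.
  by rewrite -real_normK ?num_real// ler_pXn2r// nnegrE divr_ge0// ltW.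
rewrite sumr_const expr_div_n -[X in X < _]mulr_natr -mulrA.
rewrite gtr_pMr ?exprn_gt0// mulrC ltr_pdivrMr ?exprn_gt0// mul1r -natrX ltr_nat.
by rewrite expnS expn1 (leq_trans (ltnSn _))// leq_pmulr.
Qed.

(* On the piece of the sphere where (x - a)_j has a fixed sign and is bounded
   away from 0, that coordinate is a Lipschitz function of the other ones. *)
Lemma sphere_coord a r j (tau : R) (b : bool) x y (eta : R) :
  0 < tau -> 0 <= eta -> `|x - a| = r -> `|y - a| = r ->
  tau <= (-1) ^+ b * c j (x - a) -> tau <= (-1) ^+ b * c j (y - a) ->
  (forall i, i != j -> `|c i (x - y)| <= eta) ->
  `|c j (x - y)| <= n%:R * r / tau * eta.
Proof.
move=> tau0 eta0 xr yr xj yj xy.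
have r0 : 0 <= r by rewrite -xr.
set X := x - a in xr xj; set Y := y - a in yr yj.
have xyE : x - y = X - Y by rewrite /X /Y opprB addrA subrK.
rewrite xyE in xy *.
(* Both points are on the sphere, so a change in the j-th square is compensated by the other
   squares, each of which changes by at most [2 * r * eta]. *)
have diff : c j X ^+ 2 - c j Y ^+ 2 = \sum_(i | i != j) (c i Y ^+ 2 - c i X ^+ 2).
  have := norm_expand norm_dot e_basis X; have := norm_expand norm_dot e_basis Y.
  rewrite xr yr => ->; rewrite (bigD1 j)//= [in X in _ = X -> _](bigD1 j)//= sumrB.
  by rewrite -/(c j X) -/(c j Y) => h; lra.
have sumb : `|c j X ^+ 2 - c j Y ^+ 2| <= n%:R * (2 * r * eta).
  rewrite diff; apply: le_trans (ler_norm_sum _ _ _) _.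
  apply: (@le_trans _ _ (\sum_(i < n) 2 * r * eta)).
    rewrite big_mkcond; apply: ler_sum => i _; case: ifPn => [ij|_]; last first.
      by rewrite !mulr_ge0.
    rewrite -opprB normrN subr_sqr normrM mulrC -/(c i (X - Y)).
    rewrite ler_pM ?normr_ge0//.
      apply: le_trans (ler_normD _ _) _; rewrite mulr2n mulrDl mul1r.
      by apply: lerD; [rewrite -xr|rewrite -yr]; exact: (coord_le_norm norm_dot e_basis).
    by have := xy _ ij; rewrite /c dotBr.
  by rewrite sumr_const card_ord -[leLHS]mulr_natl.
(* Equal signs prevent cancellation. Dividing the difference of squares by this sum produces the
   constant [n%:R * r / tau]. *)
have tau2 : 2 * tau <= `|c j X + c j Y|.
  have -> : `|c j X + c j Y| = `|(-1) ^+ b * (c j X + c j Y)|.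
    by rewrite normrM normrX normrN1 expr1n mul1r.
  apply: le_trans (ler_norm _); rewrite mulrDr; lra.
rewrite {1}/c dotBr -/(c j X) -/(c j Y).
rewrite -(ler_pM2r (_ : 0 < 2 * tau)) ?mulr_gt0//.
apply: (@le_trans _ _ (`|c j X - c j Y| * `|c j X + c j Y|)).
  by rewrite ler_wpM2l.
rewrite -normrM -subr_sqr; apply: le_trans sumb _.
rewrite le_eqVlt; apply/orP; left; apply/eqP; field.
by rewrite gt_eqF.
Qed.

End coordinates.
End euclidean_null_sets.

(** * Finiteness and null sets for hyperplanes and spheres *)

Section null_sets.
Context {R : realType} {V : normedModType R} (dot : {dot V for (@idfun R)}).
Hypothesis norm_dot : forall x : V, `|x| ^+ 2 = dot x x.
Implicit Types (x y z u w a : V) (A : set V).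

Lemma weighted_sum_le (T : finType) (P : pred T) (p q : T -> R) (eta : R) :
  0 <= eta -> (forall i, P i -> `|q i| <= eta) ->
  `|\sum_(i | P i) p i * q i| <= (\sum_i `|p i|) * eta.
Proof.
move=> eta0 qe; apply: le_trans (ler_norm_sum _ _ _) _.
rewrite mulr_suml big_mkcond; apply: ler_sum => i _; case: ifPn => Pi.
  by rewrite normrM ler_wpM2l// qe.
by rewrite mulr_ge0.
Qed.

(** Some coordinate of [u] is nonzero, and the equation of the hyperplane expresses the
    corresponding coordinate of [x] through the other [m]. *)
Lemma hausdorff_hyperplane_lty m (e : 'I_m.+1 -> V) u k A :
  orthonormal_basis dot e -> u != 0 -> norm_bounded A ->
  A `<=` [set x | dot u x = k] -> (hausdorff m A < +oo)%E.
Proof.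
move=> e_basis u0 bA Au.
have [j uj] := neq0_coord e_basis u0.
pose U := \sum_i `|dot (e i) u|.
apply: (@proj1 _ (hausdorff m.+1 A = 0%E)).
apply: (hausdorff_determined norm_dot e_basis (iota := lift j)) => //.
exists (1 + U / `|dot (e j) u|).
  by rewrite addr_ge0// divr_ge0// sumr_ge0.
move=> x y eta eta0 /Au xu /Au yu xy i.
have [i' ->|->] := unliftP j i.
  apply: le_trans (xy i') _; rewrite ler_peMl// lerDl divr_ge0//.
  exact: sumr_ge0.
have := dot_sub_eq0 xu yu; rewrite (dot_expand e_basis) (bigD1 j)//= => /eqP.
rewrite addrC addr_eq0 => /eqP/(congr1 Num.norm); rewrite normrN normrM => h.
rewrite mulrDl mul1r ler_wpDl// mulrAC ler_pdivlMr ?normr_gt0// mulrC -h.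
apply: weighted_sum_le => // l lj; have [l' ->|lj'] := unliftP j l; first exact: xy.
by rewrite lj' eqxx in lj.
Qed.

(** Two independent equations have a nonzero 2 by 2 minor, so Cramer's rule expresses two
    coordinates through the remaining [m]. This disposes of the points lying on two hyperplanes. *)
Lemma hausdorff_codim2 m (e : 'I_m.+2 -> V) u u' k k' A :
  orthonormal_basis dot e -> u != 0 -> (forall t, u' != t *: u) ->
  norm_bounded A ->
  A `<=` [set x | dot u x = k /\ dot u' x = k'] -> hausdorff m.+1 A = 0%E.
Proof.
move=> e_basis u0 uu' bA Au.
have [i ui] := neq0_coord e_basis u0.
(* Were all minors involving column [i] zero, [u'] would be the multiple of [u] by the ratio of
   their i-th coordinates. *)
have [j] : exists j, dot (e i) u * dot (e (lift i j)) u' -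
    dot (e (lift i j)) u * dot (e i) u' != 0.
  apply/existsP; apply: contraT; rewrite negb_exists => /forallP minor0.
  have /eqP[] := uu' (dot (e i) u' / dot (e i) u).
  set t := _ / _; rewrite [LHS](basis_expand e_basis u').
  rewrite [X in _ = _ *: X](basis_expand e_basis u) scaler_sumr.
  apply: eq_bigr => l _; rewrite scalerA /t; congr (_ *: _).
  have [j ->|->] := unliftP i l; last by rewrite mulfVK.
  have := minor0 j; rewrite negbK subr_eq0 => /eqP minorj.
  by apply: (mulfI ui); rewrite minorj; field.
set Delta := _ - _ => Delta0.
pose U := \sum_i `|dot (e i) u|; pose U' := \sum_i `|dot (e i) u'|.
have U0 : 0 <= U by exact: sumr_ge0.
have U'0 : 0 <= U' by exact: sumr_ge0.
have uU l : `|dot (e l) u| <= U by rewrite /U (bigD1 l)//= lerDl sumr_ge0.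
have uU' l : `|dot (e l) u'| <= U' by rewrite /U' (bigD1 l)//= lerDl sumr_ge0.
apply: (@proj2 (hausdorff m A < +oo)%E).
apply: (hausdorff_determined norm_dot e_basis (iota := fun k => lift i (lift j k))) => //.
exists (1 + 2 * (U * U') / `|Delta|).
  by rewrite addr_ge0// divr_ge0// !mulr_ge0.
move=> x y eta eta0 /Au[xu xu'] /Au[yu yu'] xy l.
have small (v : V) (h : R) : dot v x = h -> dot v y = h ->
    `|dot (e i) v * dot (e i) (x - y) +
      dot (e (lift i j)) v * dot (e (lift i j)) (x - y)| <=
    (\sum_i `|dot (e i) v|) * eta.
  move=> xv yv; have := dot_sub_eq0 xv yv.
  rewrite (dot_expand e_basis) (bigD1_ord i)//= (bigD1_ord j)//= addrA => /eqP.
  rewrite addr_eq0 => /eqP ->; rewrite normrN.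
  apply: le_trans (weighted_sum_le (P := xpredT)
    (fun k => dot (e (lift i (lift j k))) v) eta0 (fun k _ => xy k)) _.
  rewrite ler_wpM2r// (bigD1_ord i)//= (bigD1_ord j)//= addrA lerDr.
  by rewrite addr_ge0.
have := small u k xu yu; have := small u' k' xu' yu'.
rewrite -/U -/U'; set q := (X in `|X| <= U' * _); set p := (X in `|X| <= U * _).
move=> qU pU.
set wi := dot (e i) (x - y) in p q pU qU *.
set wj := dot (e (lift i j)) (x - y) in p q pU qU *.
(* Cramer's rule, with right-hand sides [p] and [q] that are combinations of the small
   coordinates. *)
have Ei : wi = (p * dot (e (lift i j)) u' - q * dot (e (lift i j)) u) / Delta.
  by rewrite /p /q /Delta; field.
have Ej : wj = (dot (e i) u * q - dot (e i) u' * p) / Delta.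
  by rewrite /p /q /Delta; field.
have bound (z z' : R) : `|z| <= U' -> `|z'| <= U ->
    `|(p * z - q * z') / Delta| <= (1 + 2 * (U * U') / `|Delta|) * eta.
  move=> zU zU'; rewrite [leRHS]mulrDl mul1r; apply: ler_wpDl => //.
  rewrite normrM normfV mulrAC ler_pM2r ?invr_gt0 ?normr_gt0//.
  apply: le_trans (ler_normB _ _) _; rewrite !normrM.
  rewrite (_ : _ * eta = U * eta * U' + U' * eta * U); last by ring.
  by rewrite lerD// ler_pM.
have [l' ->|->] := unliftP i l; last by rewrite -/wi Ei; exact: bound.
have [k0 ->|->] := unliftP j l'.
  apply: le_trans (xy k0) _; rewrite ler_peMl// lerDl divr_ge0//.
  by rewrite !mulr_ge0.
rewrite -/wj Ej (_ : _ - _ = - (p * dot (e i) u' - q * dot (e i) u)); last by ring.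
by rewrite mulNr normrN; exact: bound.
Qed.

(** Every point of the sphere has a large coordinate. There are finitely many choices of that
    coordinate and of its sign, and on each piece the coordinate is a Lipschitz function of the
    other [m]. *)
Lemma hausdorff_sphere_lty m (e : 'I_m.+1 -> V) a r :
  orthonormal_basis dot e -> 0 < r ->
  (hausdorff m [set x | `|x - a| = r]%R < +oo)%E.
Proof.
move=> e_basis r0.
pose tau := r / #|'I_m.+1|.+1%:R.
have tau0 : 0 < tau by rewrite divr_gt0.
pose F (t : 'I_m.+1 * bool) := [set x | `|x - a| = r /\
  tau <= (-1) ^+ t.2 * dot (e t.1) (x - a)].
apply: (@hausdorff_bigcup_lty _ _ _ _ F).
  move=> x xr.
  have [|j _ tauj] := @exists_large_coord R _ xpredT (fun j => dot (e j) (x - a)) r r0.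
    by rewrite -(norm_expand norm_dot e_basis) xr.
  exists (j, (dot (e j) (x - a) < 0)) => //; split => //=.
  by rewrite -[(-1) ^+ _ * _](_ : `|dot (e j) (x - a)| = _)//; exact: normrEsign.
move=> [j b]; apply: (@proj1 _ (hausdorff m.+1 (F (j, b)) = 0%E)).
apply: (hausdorff_determined norm_dot e_basis (iota := lift j)).
  by apply: norm_bounded_sub (norm_bounded_disk a r) => x [/= xr _]; rewrite /disk/= xr.
exists (1 + m.+1%:R * r / tau); first by rewrite addr_ge0// !mulr_ge0 ?invr_ge0// ltW.
move=> x y eta eta0 [/= xr xj] [/= yr yj] xy i.
rewrite mulrDl mul1r; have [i' ->|->] := unliftP j i.
  by apply: ler_wpDr (xy i'); rewrite !mulr_ge0 ?invr_ge0// ltW.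
apply: ler_wpDl => //; apply: (sphere_coord norm_dot e_basis (a := a) (b := b)) => //.
move=> l lj; have [l' ->|lj'] := unliftP j l; first exact: xy.
by rewrite lj' eqxx in lj.
Qed.

(** The section is a sphere of one dimension less. Its coordinate along [e ord0] is fixed, and a
    large coordinate depends on the others in a Lipschitz way, which leaves only [m] free
    coordinates. *)
Lemma hausdorff_sphere_section0 m (e : 'I_m.+2 -> V) a r k :
  orthonormal_basis dot e -> 0 < r ->
  hausdorff m.+1 [set x | `|x - a| = r /\ dot (e ord0) x = k] = 0%E.
Proof.
move=> e_basis r0.
set A := [set x | _]; pose k0 := k - dot (e ord0) a.
have sumA x : A x -> r ^+ 2 - k0 ^+ 2 =
    \sum_(j < m.+1) dot (e (lift ord0 j)) (x - a) ^+ 2.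
  move=> [xr xk]; rewrite -xr (norm_expand norm_dot e_basis) (bigD1_ord ord0)//=.
  have -> : dot (e ord0) (x - a) = k0 by rewrite dotBr xk.
  by rewrite addrAC subrr add0r.
(* [r ^+ 2 - k0 ^+ 2] is the squared radius of the section; when it is not positive, the section has
   at most one point. *)
have [s0|s0] := leP (r ^+ 2 - k0 ^+ 2) 0.
  have pt x y : A x -> A y -> x = y.
    move=> /[dup] Ax [_ xk] /[dup] Ay [_ yk].
    have zero z i : A z -> dot (e (lift ord0 i)) (z - a) = 0.
      move=> /sumA sz; apply/eqP; rewrite -sqrf_eq0 eq_le sqr_ge0 andbT.
      apply: le_trans s0; rewrite sz (bigD1 i)//= lerDl.
      by apply: sumr_ge0 => l _; exact: sqr_ge0.
    apply/eqP; rewrite -subr_eq0 -normr_le0.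
    apply: le_trans (norm_le_coord norm_dot e_basis _) _; rewrite big1// => i _.
    have [i' ->|->] := unliftP ord0 i; last by rewrite dotBr xk yk subrr normr0.
    have -> : x - y = (x - a) - (y - a) by rewrite opprB addrA subrK.
    by rewrite dotBr !zero// subrr normr0.
  have [[x Ax]|/set0P] := pselect (A !=set0).
    apply/eqP; rewrite eq_le outer_measure_ge0 andbT -(hausdorff_set1 m x).
    by apply: le_outer_measure => y /pt; exact.
  by move/negP; rewrite negbK => /eqP ->; rewrite outer_measure0.
pose s := Num.sqrt (r ^+ 2 - k0 ^+ 2).
have s1 : 0 < s by rewrite sqrtr_gt0.
pose tau := s / #|'I_m.+1|.+1%:R.
have tau0 : 0 < tau by rewrite divr_gt0.
pose F (t : 'I_m.+1 * bool) := A `&` [set x |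
  tau <= (-1) ^+ t.2 * dot (e (lift ord0 t.1)) (x - a)].
apply: (@hausdorff_bigcup0 _ _ _ _ F).
  move=> x Ax.
  have [|j _ tauj] := @exists_large_coord R _ xpredT
    (fun j => dot (e (lift ord0 j)) (x - a)) s s1.
    by rewrite -(sumA x Ax) sqr_sqrtr// ltW.
  exists (j, (dot (e (lift ord0 j)) (x - a) < 0)) => //; split => //=.
  by rewrite -[(-1) ^+ _ * _](_ : `|dot (e (lift ord0 j)) (x - a)| = _)//; exact: normrEsign.
move=> [j b]; apply: (@proj2 (hausdorff m (F (j, b)) < +oo)%E).
apply: (hausdorff_determined norm_dot e_basis (iota := fun l => lift ord0 (lift j l))).
  by apply: norm_bounded_sub (norm_bounded_disk a r) => x [[/= xr _] _]; rewrite /disk/= xr.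
exists (1 + m.+2%:R * r / tau); first by rewrite addr_ge0// !mulr_ge0 ?invr_ge0// ltW.
move=> x y eta eta0 [[xr xk] xj] [[yr yk] yj] xy.
have other i : i != lift ord0 j -> `|dot (e i) (x - y)| <= eta.
  have [i' ->|-> _] := unliftP ord0 i; last first.
    by rewrite dotBr xk yk subrr normr0.
  have [l ->|->] := unliftP j i'; last by rewrite eqxx.
  by move=> _; exact: xy.
move=> i; rewrite mulrDl mul1r; have [->|/other xyi] := eqVneq i (lift ord0 j).
  by apply: ler_wpDl => //; apply: (sphere_coord norm_dot e_basis (a := a) (b := b)).
by apply: ler_wpDr xyi; rewrite !mulr_ge0 ?invr_ge0// ltW.
Qed.

(** A reflection about [a] preserves the sphere and can carry the unit normal of the hyperplane to
    [e ord0]. The image of the hyperplane is a level set of that coordinate, in general not through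
    the origin. *)
Lemma hausdorff_sphere_hyperplane0 m (e : 'I_m.+2 -> V) a r u :
  orthonormal_basis dot e -> 0 < r -> u != 0 ->
  hausdorff m.+1 [set x | `|x - a| = r /\ dot u x = 0] = 0%E.
Proof.
move=> e_basis r0 u0.
pose v := `|u|^-1 *: u.
have v1 : `|v| = `|e ord0|.
  rewrite (norm_basis norm_dot e_basis) normrZ normfV normr_id mulVf// normr_eq0//.
pose w := v - e ord0.
rewrite -(hausdorff_reflect_at norm_dot _ a w).
apply/eqP; rewrite eq_le outer_measure_ge0 andbT.
rewrite -(@hausdorff_sphere_section0 m e a r (dot (e ord0) a - dot v a))//.
apply: le_outer_measure => x [/=]; rewrite norm_reflect_at// => xr ux; split => //.
have : dot v (reflect_at dot a w x) = 0 by rewrite dotZl ux mulr0.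
have ev : reflect dot w (e ord0) = v.
  by rewrite -[in LHS](reflect_swap norm_dot v1) reflectK.
rewrite -ev /reflect_at (dotDr dot _ a) (dot_reflect norm_dot) dotBr => h.
by apply/eqP; rewrite -subr_eq0 -[X in _ == X]h; apply/eqP; ring.
Qed.

End null_sets.

(** * Chambers as cells *)

Section chambers.
Context {R : realType} {V : normedModType R} (dot : {dot V for (@idfun R)}).
Hypothesis norm_dot : forall x : V, `|x| ^+ 2 = dot x x.
Implicit Types (x y z : V) (D H T : set V) (Hs : set (set V)).

Lemma dot_continuous u : continuous (dot u : V -> R^o).
Proof.
move=> x; apply/(@cvgrPdist_lt _ R^o) => eps eps0.
have u1 : 0 < `|u| + 1 by rewrite ltr_wpDl.
near=> y; rewrite -dotBr; apply: le_lt_trans (cauchy_schwarz norm_dot _ _) _.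
apply: (@le_lt_trans _ _ ((`|u| + 1) * `|x - y|)).
  by rewrite ler_wpM2r// lerDl.
rewrite mulrC -ltr_pdivlMr//; near: y.
by apply: cvgr_dist_lt; rewrite ?divr_gt0.
Unshelve. all: by end_near. Qed.

Lemma connected_dot_gt0 D u x0 : connected D -> (forall x, D x -> dot u x != 0) ->
  D x0 -> 0 < dot u x0 -> forall x, D x -> 0 < dot u x.
Proof.
move=> cD D0 Dx0 x00 x Dx; rewrite ltNge; apply/negP => x_le0.
have /connected_intervalP : connected ((dot u : V -> R^o) @` D).
  apply: connected_continuous_connected => //.
  by apply: continuous_subspaceT; exact: dot_continuous.
move=> /(_ (dot u x) (dot u x0)).
case/(_ _ _ 0); [by exists x|by exists x0|by rewrite x_le0 ltW|].
by move=> y Dy y0; have := D0 _ Dy; rewrite y0 eqxx.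
Qed.

Lemma convex_connected D : (forall x y (t : R), D x -> D y -> 0 <= t <= 1 ->
  D (x + t *: (y - x))) -> connected D.
Proof.
move=> cD; have [[x Dx]|/set0P/negP] := pselect (D !=set0); last first.
  by rewrite negbK => /eqP ->; exact: connected0.
rewrite (_ : D = \bigcup_(y in D) ((fun t : R => x + t *: (y - x)) @` `[0, 1]%classic)).
  apply: bigcup_connected.
    exists x => y Dy; exists 0; first by rewrite /= in_itv/= lexx ler01.
    by rewrite scale0r addr0.
  move=> y Dy; apply: connected_continuous_connected; first exact: segment_connected.
  apply: continuous_subspaceT => t.
  apply: cvgD; first exact: cvg_cst.
  exact: cvgZr_tmp.
apply/seteqP; split => [y Dy|_ [y Dy [t /= t01 <-]]].
  by exists y => //; exists 1; rewrite /= ?in_itv/= ?lexx ?ler01// scale1r addrC subrK.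
by apply: cD => //; rewrite in_itv in t01.
Qed.

Lemma hyperplaneN (u : V) : hyperplane dot (- u) = hyperplane dot u.
Proof.
apply/funext => x; rewrite /hyperplane/= dotNl; apply/propext.
by split=> [/eqP|->]; rewrite ?oppr0// oppr_eq0 => /eqP.
Qed.

Section cells.
Context (k : nat) (u : 'I_k -> V).

(** The value [true] marks the negative side. Every sign vector is allowed, even when its cell is
    empty, so that flipping one entry always stays among the indices. *)
Definition cell (s : {ffun 'I_k -> bool}) : set V :=
  [set x | forall i, 0 < (-1) ^+ s i * dot (u i) x].

Definition cell_sign (s : {ffun 'I_k -> bool}) : R := \prod_i (-1) ^+ s i.

Lemma sign_gt0_neq0 (b : bool) (z : R) : 0 < (-1) ^+ b * z -> z != 0.
Proof. by apply: contraTneq => ->; rewrite mulr0 ltxx. Qed.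

Lemma sign_gt0_inj (b b' : bool) (z : R) :
  0 < (-1) ^+ b * z -> 0 < (-1) ^+ b' * z -> b = b'.
Proof. by case: b; case: b' => //; rewrite ?expr0 ?expr1; lra. Qed.

Lemma cell_inj s s' x : cell s x -> cell s' x -> s = s'.
Proof.
by move=> sx s'x; apply/ffunP => i; exact: sign_gt0_inj (sx i) (s'x i).
Qed.

Lemma convex_gt0 (t p q : R) : 0 <= t -> t <= 1 -> 0 < p -> 0 < q ->
  0 < t * p + (1 - t) * q.
Proof.
move=> t0 t1 p0 q0; have [->|tn0] := eqVneq t 0; first by rewrite mul0r add0r subr0 mul1r.
apply: ltr_pwDl; first by rewrite mulr_gt0// lt_neqAle eq_sym tn0.
by rewrite mulr_ge0 ?subr_ge0// ltW.
Qed.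

Lemma cell_connected s : connected (cell s).
Proof.
apply: convex_connected => x y t sx sy /andP[t0 t1] i.
rewrite dotDr dotZr dotBr mulrDr.
have := sx i; have := sy i; set p := _ * _; set q := (-1) ^+ _ * _ => p0 q0.
rewrite (_ : _ + _ = t * p + (1 - t) * q); last by rewrite /p /q; ring.
exact: convex_gt0.
Qed.

Variables (Hs : set (set V)) (T0 : set V).
Hypothesis HsE : Hs = [set hyperplane dot (u i) | i in [set: 'I_k]].

Lemma arrangement_complementP x :
  arrangement_complement Hs x <-> forall i, dot (u i) x != 0.
Proof.
rewrite /arrangement_complement HsE; split=> [Hx i|ux [_ [i _ <-]]].
  by apply/eqP => ux; apply: Hx; exists (hyperplane dot (u i)) => //; exists i.
by rewrite /hyperplane/= => /eqP; exact/negP.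
Qed.

(** A cell is convex, hence connected; conversely no form vanishes on the component, so by the
    intermediate value theorem each keeps its sign there. *)
Lemma connected_component_cell s x : cell s x ->
  connected_component (arrangement_complement Hs) x = cell s.
Proof.
move=> sx; apply/seteqP; split; last first.
  apply: connected_component_max => //; last exact: cell_connected.
  by move=> y sy; apply/arrangement_complementP => i; exact: sign_gt0_neq0 (sy i).
have xx : arrangement_complement Hs x.
  by apply/arrangement_complementP => i; exact: sign_gt0_neq0 (sx i).
move=> y xy i; rewrite -dotZl.
apply: (connected_dot_gt0 (@component_connected _ _ _) _
  (connected_component_refl xx) _ xy); last by rewrite dotZl.
move=> z /connected_component_sub/arrangement_complementP/(_ i) zi.
by rewrite dotZl mulf_neq0// signr_eq0.
Qed.

Lemma complement_cell x : arrangement_complement Hs x -> exists s, cell s x.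
Proof.
move=> /arrangement_complementP ux; exists [ffun i => dot (u i) x < 0] => i.
by rewrite ffunE -normrEsign normr_gt0.
Qed.

Lemma chambersE : chambers Hs = cell @` [set s | cell s !=set0].
Proof.
apply/seteqP; split => [_ [x Cx <-]|_ [s [x sx] <-]].
  have [s sx] := complement_cell Cx.
  by exists s; [exists x|rewrite (connected_component_cell sx)].
exists x; last exact: connected_component_cell.
by apply/arrangement_complementP => i; exact: sign_gt0_neq0 (sx i).
Qed.

Hypothesis u_inj : forall i j, i != j -> hyperplane dot (u i) <> hyperplane dot (u j).
Hypothesis T0u : forall i x, T0 x -> 0 < dot (u i) x.
Hypothesis T0_neq0 : T0 !=set0.

(** [separates] allows any normal [v] of the hyperplane, not just [u i]. If [u i] is positive at a
    point of the cell and at a point of [T0], it is positive on the segment between them, which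
    excludes a normal of opposite signs at its ends. *)
Lemma separates_cell s i : cell s !=set0 ->
  separates dot (hyperplane dot (u i)) (cell s) T0 <-> s i.
Proof.
move=> [x sx]; have [y T0y] := T0_neq0; split=> [[v [uv sv T0v]]|si].
  have vx := sv x sx; have vy := T0v y T0y; rewrite /= in vx vy.
  apply: contraT => /negbTE nsi; have := sx i; rewrite nsi expr0 mul1r => ux.
  have uy := T0u i T0y.
  (* The parameter at which the segment from [x] to [y] crosses the zero set of [v]. *)
  pose t := dot v x / (dot v x - dot v y).
  have t0 : 0 <= t by rewrite divr_ge0//; lra.
  have t1 : t <= 1 by rewrite ler_pdivrMr; lra.
  have : hyperplane dot v (x + t *: (y - x)).
    rewrite /hyperplane/= dotDr dotZr dotBr /t; field.
    by rewrite subr_eq0 gt_eqF// (lt_trans vy).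
  rewrite -uv /hyperplane/= dotDr dotZr dotBr => h.
  suff : 0 < dot (u i) x + t * (dot (u i) y - dot (u i) x) by rewrite h ltxx.
  rewrite (_ : _ + _ = t * dot (u i) y + (1 - t) * dot (u i) x); last by ring.
  exact: convex_gt0.
exists (- u i); split.
- by rewrite hyperplaneN.
- by move=> z /(_ i); rewrite si expr1 mulN1r /= dotNl.
- by move=> z /(T0u i); rewrite /= dotNl oppr_lt0.
Qed.

(** The separating hyperplanes correspond to the entries [true] of [s]; as the hyperplanes are
    pairwise distinct, none is counted twice. *)
Lemma chamber_sign_cell s : cell s !=set0 ->
  chamber_sign dot Hs T0 (cell s) = cell_sign s.
Proof.
move=> s0; rewrite /chamber_sign /cell_sign.
have -> : [set H | Hs H /\ separates dot H (cell s) T0] =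
    [set` [fset hyperplane dot (u i) | i in [pred i | s i]]%fset].
  apply/seteqP; split => H /=.
    move=> []; rewrite HsE => -[i _ <-] /(separates_cell i s0) si.
    by apply/imfsetP; exists i.
  move=> /imfsetP[i /= si ->]; split; first by rewrite HsE; exists i.
  by apply/separates_cell.
rewrite set_fsetK card_imfset/=; last first.
  move=> i j /eqP; apply: contraTeq => /u_inj ij; exact/eqP.
rewrite -cardE -prodr_const big_mkcond; apply: eq_bigr => i _.
by rewrite unfold_in /=; case: (s i).
Qed.

(** Distinct sign vectors with nonempty cells give distinct chambers, and the empty cells join the
    sum with value 0. *)
Lemma fsbig_chambers (G : set V -> \bar R) : G set0 = 0%E ->
  (\sum_(T \in chambers Hs) (chamber_sign dot Hs T0 T)%:E * G T =
   \sum_s (cell_sign s)%:E * G (cell s))%E.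
Proof.
move=> G0; rewrite chambersE fsbig_image; last first.
  move=> s s'; rewrite !inE => -[x sx] _ ss'; apply: (cell_inj sx).
  by rewrite -ss'.
rewrite [RHS]fsbig_seq ?index_enum_uniq//.
rewrite -[RHS](fsbig_widen [set s | cell s !=set0]).
- by apply: eq_fsbigr => s; rewrite inE => s0; rewrite chamber_sign_cell.
- by move=> s _; rewrite /= mem_index_enum.
- move=> s [_ /= /set0P/negP]; rewrite negbK => /eqP ->.
  by rewrite G0 mule0.
Qed.

End cells.
End chambers.

(** * Closures, boundaries and facets of cells *)

Section cell_geometry.
Context {R : realType} {V : normedModType R} (dot : {dot V for (@idfun R)}).
Hypothesis norm_dot : forall x : V, `|x| ^+ 2 = dot x x.
Implicit Types (x y z : V) (D H T : set V) (Hs : set (set V)).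

(** The normals are oriented towards [T0], which makes [T0] the cell whose sign vector is constantly
    [false]. *)
Lemma arrangement_index Hs T0 : arrangement dot Hs -> chambers Hs T0 ->
  exists k (u : 'I_k -> V), [/\ forall i, u i != 0,
    Hs = [set hyperplane dot (u i) | i in [set: 'I_k]],
    forall i j, i != j -> hyperplane dot (u i) <> hyperplane dot (u j),
    forall i x, T0 x -> 0 < dot (u i) x & T0 !=set0].
Proof.
move=> [finHs HsH] [x0 Cx0 T0E].
have T0x0 : T0 x0 by rewrite -T0E; exact: connected_component_refl.
pose X : seq (set V) := enum_fset (fset_set Hs).
have XHs H : (H \in X) = (H \in Hs) by rewrite -in_fset_set.
have Xu : uniq X by exact: fset_uniq.
pose F (i : 'I_(size X)) := nth set0 X i.
have FHs i : Hs (F i) by apply/set_mem; rewrite -XHs mem_nth.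
have /choice[u uP] : forall i : 'I_(size X), exists v, [/\ v != 0,
    F i = hyperplane dot v & forall x, T0 x -> 0 < dot v x].
  move=> i; have [v v0 Fv] := HsH _ (FHs i).
  have vT0 x : T0 x -> dot v x != 0.
    rewrite -T0E => /connected_component_sub Cx; apply/eqP => vx; apply: Cx.
    by exists (F i) => //; rewrite Fv.
  have cT0 : connected T0 by rewrite -T0E; exact: component_connected.
  have [v_gt0|v_le0] := ltP 0 (dot v x0).
    by exists v; split => //; exact: (connected_dot_gt0 norm_dot cT0 vT0 T0x0).
  exists (- v); rewrite oppr_eq0 hyperplaneN; split => //.
  apply: (connected_dot_gt0 norm_dot cT0 _ T0x0).
    by move=> x /vT0; rewrite dotNl oppr_eq0.
  by rewrite dotNl oppr_gt0 lt_neqAle vT0.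
exists (size X), u; split.
- by move=> i; have [] := uP i.
- apply/seteqP; split => [H /mem_set|_ [i _ <-]]; last first.
    by have [_ <- _] := uP i.
  rewrite -XHs => HX; have Hi : (index H X < size X)%N by rewrite index_mem.
  exists (Ordinal Hi) => //; have [_ <- _] := uP (Ordinal Hi).
  by rewrite /F/= nth_index.
- move=> i j ij; have [_ <- _] := uP i; have [_ <- _] := uP j => /eqP.
  by rewrite /F nth_uniq// => /eqP/ord_inj/eqP; exact/negP.
- by move=> i x; have [_ _] := uP i; exact.
- by exists x0.
Qed.

Context (k : nat) (u : 'I_k -> V).
Hypothesis u_neq0 : forall i, u i != 0.
Local Notation cell := (cell dot u).
Implicit Types s : {ffun 'I_k -> bool}.

(** The open facet: its points lie on no hyperplane but the i-th. The entry [s i] is not consulted,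
    so the cells on both sides have literally the same facet. *)
Definition facet (s : {ffun 'I_k -> bool}) i : set V :=
  [set x | dot (u i) x = 0 /\ forall j, j != i -> 0 < (-1) ^+ s j * dot (u j) x].

Lemma closed_dot_ge0 (v : V) : closed [set x | 0 <= dot v x].
Proof.
rewrite (_ : [set _ | _] = (dot v : V -> R^o) @^-1` [set z | 0 <= z]) //.
by apply: preimage_closed; [move=> x _; exact: dot_continuous|exact: closed_ge].
Qed.

Lemma open_dot_gt0 (v : V) : open [set x | 0 < dot v x].
Proof.
rewrite (_ : [set _ | _] = (dot v : V -> R^o) @^-1` [set z | 0 < z]) //.
by apply: open_comp; [move=> x _; exact: dot_continuous|exact: open_gt].
Qed.

Lemma open_forall (I : finType) (F : I -> set V) : (forall i, open (F i)) ->
  open [set x | forall i, F i x].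
Proof.
move=> oF; rewrite openE => x Fx.
rewrite /interior (_ : [set _ | _] =
    \bigcap_(i in [set` [fset i | i in I]%fset]) F i); last first.
  by apply/seteqP; split => [y Fy i _|y Fy i]; apply: Fy; rewrite //= in_imfset.
by apply: filter_bigI => i _; apply: open_nbhs_nbhs.
Qed.

Lemma open_cell s : open (cell s).
Proof.
rewrite (_ : cell s = [set x | forall i, 0 < dot ((-1) ^+ s i *: u i) x]).
  by apply: open_forall => // i; exact: open_dot_gt0.
by apply/seteqP; split => x sx i /=; have := sx i; rewrite /= dotZl.
Qed.

Lemma cell_segment s x z (t : R) : 0 < t -> t <= 1 ->
  (forall i, 0 <= (-1) ^+ s i * dot (u i) x) -> cell s z ->
  cell s (x + t *: (z - x)).
Proof.
move=> t0 t1 sx sz i; rewrite dotDr dotZr dotBr.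
have := sx i; have := sz i; move: ((-1) ^+ s i : R) => b bz bx.
rewrite (_ : b * _ = t * (b * dot (u i) z) + (1 - t) * (b * dot (u i) x)); last by ring.
by apply: ltr_pwDl; [rewrite mulr_gt0|rewrite mulr_ge0// subr_ge0].
Qed.

(** From a point satisfying the weak inequalities, an arbitrarily small step towards a point of the
    cell makes all of them strict. *)
Lemma closure_cell s : cell s !=set0 ->
  closure (cell s) = [set x | forall i, 0 <= (-1) ^+ s i * dot (u i) x].
Proof.
move=> [z sz]; apply/seteqP; split => x.
  move=> sx i; rewrite -dotZl.
  suff : closure [set y | 0 <= dot ((-1) ^+ s i *: u i) y] x.
    by rewrite -(closure_id _).1//; exact: closed_dot_ge0.
  apply: closureS sx => y /(_ i) /ltW; by rewrite /= dotZl.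
move=> sx B /nbhs_ballP[eps /= eps0 xB].
pose t := Num.min 1 (eps / (`|z - x| + 1) / 2).
have c0 : 0 < eps / (`|z - x| + 1) by rewrite divr_gt0// ltr_wpDl.
have t0 : 0 < t by rewrite lt_min ltr01 divr_gt0.
exists (x + t *: (z - x)); split.
  by apply: cell_segment => //; rewrite ge_min lexx.
apply: xB; rewrite -ball_normE /= opprD addrA subrr add0r normrN normrZ gtr0_norm//.
apply: (@le_lt_trans _ _ (t * (`|z - x| + 1))).
  by rewrite ler_wpM2l// ?lerDl// ltW.
rewrite -ltr_pdivlMr ?ltr_wpDl//.
apply: (@le_lt_trans _ _ (eps / (`|z - x| + 1) / 2)); first by rewrite ge_min lexx orbT.
by rewrite ltr_pdivrMr// mulr_natr mulr2n ltrDl.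
Qed.

Lemma closed_disk_norm a r : closed (disk a r : set V).
Proof.
rewrite (_ : disk a r = (fun x => `|x - a| : R^o) @^-1` [set z | z <= r])//.
apply: preimage_closed; last exact: closed_le.
by move=> x _; apply: cvg_norm; apply: cvgB; [exact: cvg_id|exact: cvg_cst].
Qed.

Lemma nbhs_step x v (A : set V) : nbhs x A -> exists2 t : R, 0 < t & A (x + t *: v).
Proof.
move=> /nbhs_ballP[eps /= eps0 xA].
have c0 : 0 < eps / (`|v| + 1) by rewrite divr_gt0// ltr_wpDl.
have t0 : 0 < eps / (`|v| + 1) / 2 by rewrite divr_gt0.
exists (eps / (`|v| + 1) / 2) => //.
apply: xA; rewrite -ball_normE /= opprD addrA subrr add0r normrN normrZ gtr0_norm//.
apply: (@le_lt_trans _ _ (eps / (`|v| + 1) / 2 * (`|v| + 1))).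
  by rewrite ler_wpM2l// ?lerDl// ltW.
rewrite mulrAC divfK ?gt_eqF ?ltr_wpDl//.
by rewrite ltr_pdivrMr// mulr_natr mulr2n ltrDl.
Qed.

Lemma open_norm_lt a r : open [set x : V | `|x - a| < r].
Proof.
rewrite (_ : [set _ | _] = (fun x : V => `|x - a| : R^o) @^-1` [set z | z < r])//.
apply: open_comp; last exact: open_lt.
by move=> y _; apply: cvg_norm; apply: cvgB; [exact: cvg_id|exact: cvg_cst].
Qed.

(** An interior point can move a little in every direction. Moving away from [a] rules out the
    sphere, and moving against the sign of a vanishing form rules out the hyperplanes. *)
Lemma interior_disk_cell a r s : 0 < r -> cell s !=set0 ->
  (disk a r `&` closure (cell s))° = [set x | `|x - a| < r] `&` cell s.
Proof.
move=> r0 s0; apply/seteqP; split => [x xX|x [xr sx]]; last first.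
  have o : open ([set x | `|x - a| < r] `&` cell s).
    by apply: openI; [exact: open_norm_lt|exact: open_cell].
  rewrite /interior; apply: (@filterS _ _ _ ([set x | `|x - a| < r] `&` cell s)).
    by move=> y [/ltW yr sy]; split => //; exact: subset_closure.
  by apply: open_nbhs_nbhs; split.
have [xr sx] := interior_subset xX.
have step v : exists2 t : R, 0 < t & (disk a r `&` closure (cell s)) (x + t *: v).
  exact: nbhs_step.
split=> /=.
  rewrite lt_neqAle xr andbT; apply/eqP => xra.
  have [t t0 [+ _]] := step (x - a).
  rewrite /disk/= addrAC -[X in X + _]scale1r -scalerDl normrZ xra.
  rewrite gtr0_norm ?addr_gt0// mulrDl mul1r -subr_ge0 opprD addrA subrr add0r.
  by rewrite oppr_ge0 leNgt mulr_gt0.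
move=> i; have := sx; rewrite closure_cell// => /(_ i); rewrite le_eqVlt => /orP[/eqP six|//].
have [t t0 [_]] := step (- ((-1) ^+ s i *: u i)).
rewrite closure_cell// => /(_ i); rewrite scalerN dotBr !dotZr mulrBr -six sub0r.
rewrite mulrCA [X in t * X]mulrA -expr2 sqrr_sign mul1r oppr_ge0 leNgt mulr_gt0//.
exact: dotxx_gt0.
Qed.

Lemma boundary_disk_cell a r s : 0 < r -> cell s !=set0 ->
  boundary (disk a r `&` closure (cell s)) =
  ([set x | `|x - a| = r] `&` cell s) `|`
  (disk a r `&` (closure (cell s) `\` cell s)).
Proof.
move=> r0 s0; rewrite /boundary interior_disk_cell//.
rewrite -(closure_id _).1; last first.
  by apply: closedI; [exact: closed_disk_norm|exact: closed_closure].
apply/seteqP; split => x.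
  move=> [[xr sx] nx]; have [sx'|sx'] := pselect (cell s x); last by right.
  left; split => //=; apply/eqP; rewrite eq_le; apply/andP; split; first exact: xr.
  by rewrite leNgt; apply/negP => xr'; apply: nx.
move=> [[/= xr sx]|[xr [sx nsx]]].
  split; last by rewrite /= xr ltxx => -[].
  by split; [rewrite /disk/= xr|exact: subset_closure].
by split => // -[_].
Qed.

(** The ball is strictly convex: the midpoint of two distinct points is inside the open ball and in
    the closure of the cell, so the open ball meets the cell. Hence the doubling in [surface_volume]
    concerns at most single points. *)
Lemma disk_cell_degenerate a r s x y : 0 < r -> cell s !=set0 ->
  (disk a r `&` closure (cell s))° = set0 ->
  (disk a r `&` closure (cell s)) x -> (disk a r `&` closure (cell s)) y -> x = y.
Proof.
move=> r0 s0; rewrite interior_disk_cell// => int0 [xr sx] [yr sy].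
apply/eqP; apply: contraT => xy.
pose z := x + 2^-1 *: (y - x).
have za : `|z - a| < r.
  rewrite -(ltr_pXn2r (_ : 0 < 2)%N) ?nnegrE ?(ltW r0)// norm_dot.
  have xr2 : dot (x - a) (x - a) <= r ^+ 2.
    by rewrite -norm_dot ler_pXn2r ?nnegrE ?(ltW r0).
  have yr2 : dot (y - a) (y - a) <= r ^+ 2.
    by rewrite -norm_dot ler_pXn2r ?nnegrE ?(ltW r0).
  have xy2 : 0 < dot (x - y) (x - y) by apply: dotxx_gt0; rewrite // subr_eq0.
  move: xr2 yr2 xy2; rewrite /z !(dotBl, dotBr, dotDl, dotDr, dotZl, dotZr).
  rewrite (dotC dot y x) (dotC dot a x) (dotC dot a y); lra.
have sz : closure (cell s) z.
  move: sx sy; rewrite closure_cell// => sx sy i; rewrite /z dotDr dotZr dotBr.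
  have := sx i; have := sy i; rewrite /=.
  move: ((-1) ^+ s i : R) (dot (u i) x) (dot (u i) y) => b p q bq bp.
  rewrite (_ : b * _ = 2^-1 * (b * p) + 2^-1 * (b * q)); last by field.
  by rewrite addr_ge0// mulr_ge0// invr_ge0.
have /sz[w [sw wr]] : nbhs z [set x | `|x - a| < r].
  by apply: open_nbhs_nbhs; split => //; exact: open_norm_lt.
suff : (set0 : set V) w by [].
by rewrite -int0.
Qed.

(** A small step off the i-th hyperplane, to the side given by [s i], preserves the other strict
    inequalities. *)
Lemma facet_cell s i x : facet s i x -> cell s !=set0.
Proof.
move=> [ux sx].
have : nbhs x [set y | forall j, j != i -> 0 < dot ((-1) ^+ s j *: u j) y].
  apply: open_nbhs_nbhs; split; last by move=> j /= ji; rewrite dotZl; exact: sx.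
  apply: (@open_forall _ (fun j => [set y | j != i -> 0 < dot ((-1) ^+ s j *: u j) y])).
  move=> j; have [_|ji] := eqVneq j i.
    by rewrite (_ : [set _ | _] = setT); [exact: openT|apply/seteqP; split].
  rewrite (_ : [set _ | _] = [set y | 0 < dot ((-1) ^+ s j *: u j) y]).
    exact: open_dot_gt0.
  by apply/seteqP; split => y /=; [move/(_ isT)|move=> ?].
move=> /(nbhs_step ((-1) ^+ s i *: u i))[t t0 xt].
exists (x + t *: ((-1) ^+ s i *: u i)) => j.
have [->|ji] := eqVneq j i; last by have := xt j ji; rewrite /= dotZl.
rewrite dotDr ux add0r !dotZr mulrCA [X in t * X]mulrA -expr2 sqrr_sign mul1r.
by rewrite mulr_gt0// dotxx_gt0.
Qed.

End cell_geometry.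

(** * Comparison of areas on the sphere *)

Section integral_along_level_sets.
Context d (T : measurableType d) (R : realType) (lam : {measure set T -> \bar R}).
Local Open Scope ereal_scope.

Lemma ge0_integral_mrestr (D : set T) (mD : measurable D) (f : T -> \bar R) :
  measurable_fun setT f -> (forall x, 0 <= f x) ->
  \int[mrestr lam mD]_x f x = \int[lam]_(x in D) f x.
Proof.
move=> mf f0; have mDC : measurable (~` D) by exact: measurableC.
rewrite -(setUv D) ge0_integral_setU//; last 2 first.
- by rewrite setUv.
- by rewrite disj_set2E setICr.
rewrite [X in _ + X](_ : _ = 0) ?adde0.
  apply: eq_measure_integral => A mA AD /=.
  by rewrite /mrestr setIidl.
rewrite -(integral_measure_zero (~` D) f); apply: eq_measure_integral => A mA AD /=.
by rewrite /mrestr /mzero (_ : _ `&` _ = set0) ?measure0//; apply/disjoints_subset.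
Qed.

Variables (P M : set T) (mP : measurable P) (mM : measurable M).
Variables (N : T -> R) (mN : measurable_fun setT N) (r0 r1 : R).

Let B t := [set y | (N y <= t)%R].

Hypothesis lamB : lam (B r1) < +oo.
(** The shells [t < N y <= r1] of [P] and [M] have the same measure; the sums avoid subtraction of
    extended reals. *)
Hypothesis balance : forall t, (r0 <= t <= r1)%R ->
  lam (P `&` B t) + lam (M `&` B r1) = lam (P `&` B r1) + lam (M `&` B t).

Let mB t : measurable (B t).
Proof.
rewrite -[X in measurable X]setTI; apply: measurable_fun_le => //.
Qed.

Let fin_ball (D : set T) t : measurable D -> (t <= r1)%R ->
  lam (D `&` B t) \is a fin_num.
Proof.
move=> mD tr; rewrite ge0_fin_numE//; apply: le_lt_trans lamB.
apply: le_measure; rewrite ?inE//; first exact: measurableI.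
by move=> y [_]; rewrite /B/= => /le_trans; exact.
Qed.

Let shell_balance t : (r0 <= t)%R ->
  lam (P `&` N @^-1` `]t, r1]) = lam (M `&` N @^-1` `]t, r1]).
Proof.
move=> r0t; have [tr1|r1t] := leP t r1; last first.
  rewrite (_ : `]t, r1]%classic = set0) ?preimage_set0 ?setI0 ?measure0//.
  by apply/seteqP; split => z //=; rewrite in_itv/= => /andP[tz zr]; lra.
have shell D : measurable D ->
    lam (D `&` N @^-1` `]t, r1]) = lam (D `&` B r1) - lam (D `&` B t).
  move=> mD; rewrite (_ : _ `&` _ = (D `&` B r1) `\` (D `&` B t)).
    rewrite measureD//; [|exact: measurableI|exact: measurableI|].
      congr (_ - lam _); rewrite setIACA setIid; congr (_ `&` _).
      by apply/setIidr => y; rewrite /B/= => /le_trans; exact.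
    by rewrite -ge0_fin_numE// fin_ball.
  apply/seteqP; split => y; rewrite /B /= in_itv/=.
    by move=> [Dy /andP[ty yr]]; split => // -[_]; rewrite leNgt ty.
  by move=> [[Dy yr] nt]; split => //; rewrite yr andbT ltNge; apply/negP => yt; exact: nt.
rewrite !shell//.
have fP := fin_ball mP (lexx r1); have fM := fin_ball mM (lexx r1).
have fPt := fin_ball mP tr1; have fMt := fin_ball mM tr1.
have := balance (_ : r0 <= t <= r1)%R; rewrite r0t tr1 => /(_ isT).
rewrite -(fineK fP) -(fineK fM) -(fineK fPt) -(fineK fMt).
by rewrite -!EFinB -!EFinD => -[h]; congr EFin; lra.
Qed.

(** Push the restrictions of [lam] to [P] and to [M] forward along [N]. The two measures on the line
    agree on the intervals []t, r1]] with [r0 <= t], hence on all Borel subsets of []r0, r1]], where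
    [h] lives. *)
Lemma eq_integral_level (h : R -> \bar R) : measurable_fun setT h ->
  (forall t, 0 <= h t) -> (forall t, ~~ (r0 < t <= r1)%R -> h t = 0) ->
  \int[lam]_(y in P) h (N y) = \int[lam]_(y in M) h (N y).
Proof.
move=> mh h0 hout.
pose I : set (measurableTypeR R) := `]r0, r1]%classic.
have mI : measurable I by exact: measurable_itv.
pose N' : T -> measurableTypeR R := N.
have mN' : measurable_fun setT N' by [].
pose push D (mD : measurable D) : {measure set (measurableTypeR R) -> \bar R} :=
  measure_function_pushforward__canonical__measure_function_Measure
    (mrestr lam mD) mN'.
have pushE D (mD : measurable D) :
    \int[lam]_(y in D) h (N y) = \int[push D mD]_(t in I) h t.
  rewrite -(ge0_integral_mrestr mD); last 2 first.
  - exact: measurableT_comp.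
  - by move=> x; exact: h0.
  rewrite -[LHS]/(\int[mrestr lam mD]_(y in N' @^-1` setT) (h \o N') y).
  rewrite -(ge0_integral_pushforward mN')// -[in RHS](setTI I) integral_mkcondr.
  apply: eq_integral => t _; rewrite patchE; case: ifPn => //.
  rewrite notin_setE => nt; rewrite hout//; apply/negP => rt; apply: nt.
  by rewrite /I/= in_itv.
rewrite !pushE; apply: eq_measure_integral => A mA AI.
pose res D (mD : measurable D) : {measure set (measurableTypeR R) -> \bar R} :=
  mrestr (push D mD) mI.
have resA D (mD : measurable D) : push D mD A = res D mD A.
  by rewrite /res/= /mrestr setIidl.
rewrite !resA.
(* The open upper half lines generate the Borel sets and are stable under intersection. Cut down to
   [I], each becomes a shell with lower end [Num.max t r0]. *)
apply: (@measure_unique _ R (measurableTypeR R) (@RGenOInfty.G R)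
  (fun k => `](- k%:R)%R, +oo[%classic) (@RGenOInfty.measurableE R) _ _ _
  (res P mP) (res M mM)) => //.
- move=> _ _ [s ->] [t ->]; exists (Num.max s t).
  apply/seteqP; split => z /=; rewrite !in_itv/= !andbT gt_max; first by move=> [-> ->].
  by move=> /andP[].
- by move=> k; exists (- k%:R)%R.
- apply/seteqP; split => // z _; exists (Num.truncn `|z|).+1 => //=.
  rewrite in_itv/= andbT ltrNl; apply: le_lt_trans (ler_norm _) _.
  by rewrite normrN; exact: truncnS_gt.
- move=> _ [t ->]; rewrite /mrestr /= /pushforward /mrestr.
  have -> : `]t, +oo[%classic `&` I = `](Num.max t r0), r1]%classic.
    apply/seteqP; split => z /=; rewrite /I/= !in_itv/= andbT gt_max.
      by move=> [-> /andP[-> ->]].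
    by move=> /andP[/andP[-> ->] ->].
  rewrite setIC [in RHS]setIC; apply: shell_balance.
  by rewrite le_max lexx orbT.
- move=> k; rewrite /mrestr /= /pushforward /mrestr.
  apply: le_lt_trans lamB; apply: le_measure; rewrite ?inE//.
    apply: measurableI => //; rewrite -[X in measurable X]setTI; apply: mN => //.
    by apply: measurableI => //; exact: measurable_itv.
  by move=> y [[_ /=]]; rewrite /I/= in_itv/= => /andP[_].
Qed.

End integral_along_level_sets.

(** * Double counting with a kernel *)

Section kernel_comparison.
Context d1 d2 (T1 : measurableType d1) (T2 : measurableType d2) (R : realType).
Variables (mu : {sigma_finite_measure set T1 -> \bar R})
  (lam : {sigma_finite_measure set T2 -> \bar R}).
Variables (K : set (T1 * T2)) (mK : measurable K).
Variables (S : set T1) (mS : measurable S) (w : R).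
Local Open Scope ereal_scope.

Hypothesis K_section : forall x, lam (xsection K x) = w%:E * (\1_S x)%:E.
Hypothesis w_gt0 : (0 < w)%R.

Lemma kernel_measurel A : measurable A ->
  (mu \x lam) (K `&` (A `*` setT)) = w%:E * mu (A `&` S).
Proof.
move=> mA; rewrite /product_measure1.
transitivity (\int[mu]_x (w%:E * (\1_(A `&` S) x)%:E)).
  apply: eq_integral => x _ /=; rewrite xsectionI; have [xA|xA] := boolP (x \in A).
    by rewrite in_xsectionX// setIT K_section !indicE in_setI xA.
  by rewrite notin_xsectionX// setI0 measure0 indicE in_setI (negbTE xA) mule0.
rewrite ge0_integralZl//=.
- by rewrite integral_indic ?setIT//; exact: measurableI.
- by apply/measurable_EFinP; apply: measurable_indic; exact: measurableI.
- by rewrite lee_fin ltW.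
Qed.

(** Tonelli's theorem: by uniqueness, the product measure is also obtained by integrating in the
    other order. *)
Lemma kernel_measurer A : measurable A ->
  (mu \x lam) (K `&` (setT `*` A)) = \int[lam]_(y in A) mu (ysection K y).
Proof.
move=> mA; have mKA : measurable (K `&` (setT `*` A)).
  by apply: measurableI => //; exact: measurableX.
have -> : (mu \x lam) (K `&` (setT `*` A)) = (mu \x^ lam) (K `&` (setT `*` A)).
  by apply: product_measure_unique => // B C mB mC; exact: product_measure2E.
rewrite /product_measure2 [RHS]integral_mkcond; apply: eq_integral => y _ /=.
rewrite ysectionI patchE; case: ifPn => yA; first by rewrite in_ysectionX// setIT.
by rewrite notin_ysectionX// setI0 measure0.
Qed.

Hypothesis mu_fin : forall A, mu A < +oo.

(** Up to the factor [w], the pairs over [P] measure [P]. They end in [P'] or start in [N]; the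
    pairs ending in [M'] start in [M] or in [N]. The equality of the two middle integrals links both
    counts, at the cost of one error term for each. *)
Lemma kernel_le (P M N : set T1) (P' M' : set T2) :
  measurable P -> measurable M -> measurable N -> measurable P' -> measurable M' ->
  K `&` (P `*` setT) `<=` (setT `*` P') `|` (N `*` setT) ->
  K `&` (setT `*` M') `<=` (M `*` setT) `|` (N `*` setT) ->
  \int[lam]_(y in P') mu (ysection K y) = \int[lam]_(y in M') mu (ysection K y) ->
  mu (P `&` S) <= mu (M `&` S) + (mu (N `&` S) + mu (N `&` S)).
Proof.
move=> mP mM mN mP' mM' KP KM PM.
have mX A B : measurable A -> measurable B -> measurable (K `&` (A `*` B)).
  by move=> mA mB; apply: measurableI => //; exact: measurableX.
have fin A : mu A \is a fin_num by rewrite ge0_fin_numE.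
rewrite -(@lee_pmul2l _ w%:E)//.
rewrite /= muleDr ?fin_num_adde_defl//; last by rewrite fin_numD !fin.
rewrite muleDr ?fin_num_adde_defl//.
rewrite -!kernel_measurel//.
apply: (@le_trans _ _ ((mu \x lam) (K `&` (setT `*` P')) + (mu \x lam) (K `&` (N `*` setT)))).
  apply: le_trans (measureU2 _ _ _); [|exact: mX|exact: mX].
  apply: le_measure; rewrite ?inE; [exact: mX|by apply: measurableU; exact: mX|].
  by move=> z Kz; have [] := KP z Kz; [left|right]; split => //; case: Kz.
rewrite kernel_measurer// PM -kernel_measurer// [leRHS]addeA; apply: leeD => //.
apply: le_trans (measureU2 _ _ _); [|exact: mX|exact: mX].
apply: le_measure; rewrite ?inE; [exact: mX|by apply: measurableU; exact: mX|].
by move=> z Kz; have [] := KM z Kz; [left|right]; split => //; case: Kz.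
Qed.

End kernel_comparison.

(** * Borel sets in coordinates *)

Section measurability_in_coordinates.
Context {R : realType} {V : normedModType R} (dot : {dot V for (@idfun R)}).
Hypothesis norm_dot : forall x : V, `|x| ^+ 2 = dot x x.
Context (n : nat) (e : 'I_n -> V).
Hypothesis e_basis : orthonormal_basis dot e.
Implicit Types (x z v a : V) (A : set V) (d : nat).
Local Notation vec := (vec e).
Local Notation coord := (coord dot e).

(** Borel measurability in [V] is expressed on tuples, where the sigma-algebra and Lebesgue measure
    live. *)
Definition coord_measurable A := measurable (vec @^-1` A).

Lemma measurable_dot_vec v : measurable_fun setT (fun y : n.-tuple R => dot v (vec y)).
Proof.
rewrite (_ : (fun _ => _) = (fun y => \sum_i dot v (e i) * tnth y i)).
  apply: measurable_sum => i; apply: measurable_funM => //; exact: measurable_tnth.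
apply/funext => y; rewrite dot_sumr; apply: eq_bigr => i _.
by rewrite dotZr mulrC.
Qed.

Lemma measurable_norm_vec a : measurable_fun setT (fun y : n.-tuple R => `|vec y - a|).
Proof.
rewrite (_ : (fun _ => _) =
    (fun y => Num.sqrt (\sum_i (tnth y i - tnth (coord a) i) ^+ 2))).
  apply: measurableT_comp; last exact: measurable_tuple_poly.
  exact: continuous_measurable_fun (@sqrt_continuous R).
apply/funext => y; rewrite -[LHS]ger0_norm// -sqrtr_sqr; congr Num.sqrt.
rewrite (norm_expand norm_dot e_basis); apply: eq_bigr => i _.
by rewrite dotBr tnth_mktuple -(dot_basis_sum e_basis i (tnth y)).
Qed.

Lemma tuple_ballE z rho : 0 <= rho ->
  tuple_ball (coord z) rho = [set y | `|vec y - z| <= rho].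
Proof.
move=> rho0; apply/funext => y; rewrite /tuple_ball/=.
rewrite -[in RHS](ler_pXn2r (_ : 0 < 2)%N) ?nnegrE// (norm_expand norm_dot e_basis).
congr (is_true (_ <= _)); apply: eq_bigr => i _.
by rewrite dotBr tnth_mktuple -(dot_basis_sum e_basis i (tnth y)).
Qed.

Lemma coord_measurable_dot_le v c : coord_measurable [set x | dot v x <= c].
Proof.
rewrite /coord_measurable -[X in measurable X]setTI; apply: measurable_fun_le => //.
exact: measurable_dot_vec.
Qed.

Lemma coord_measurableI A (B : set V) : coord_measurable A -> coord_measurable B ->
  coord_measurable (A `&` B).
Proof. by move=> mA mB; rewrite /coord_measurable preimage_setI; exact: measurableI. Qed.

Lemma coord_measurableC A : coord_measurable A -> coord_measurable (~` A).
Proof. by move=> mA; rewrite /coord_measurable preimage_setC; exact: measurableC. Qed.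

Lemma coord_measurable_exists (T : finType) (F : T -> set V) :
  (forall t, coord_measurable (F t)) -> coord_measurable [set x | exists t, F t x].
Proof.
move=> mF; rewrite /coord_measurable.
rewrite (_ : _ @^-1` _ = \bigcup_(t in [set: T]) (vec @^-1` F t)).
  by apply: fin_bigcup_measurable => // t _; exact: mF.
by apply/seteqP; split => [y [t Ft]|y [t _ Ft]]; exists t.
Qed.

Lemma coord_measurable_forall (T : finType) (F : T -> set V) :
  (forall t, coord_measurable (F t)) -> coord_measurable [set x | forall t, F t x].
Proof.
move=> mF; rewrite (_ : [set _ | _] = ~` [set x | exists t, (~` F t) x]).
  by apply: coord_measurableC; apply: coord_measurable_exists => t; exact: coord_measurableC.
apply/seteqP; split => x; first by move=> Fx [t]; apply.
by move=> nF t; apply: contrapT => Ft; apply: nF; exists t.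
Qed.

Lemma coord_measurable_dot_gt0 v : coord_measurable [set x | 0 < dot v x].
Proof.
rewrite (_ : [set _ | _] = ~` [set x | dot v x <= 0]).
  by apply: coord_measurableC; exact: coord_measurable_dot_le.
by apply/seteqP; split => x /=; rewrite ltNge => /negP.
Qed.

Lemma coord_measurable_norm_le a c : coord_measurable [set x | `|x - a| <= c].
Proof.
rewrite /coord_measurable -[X in measurable X]setTI; apply: measurable_fun_le => //.
exact: measurable_norm_vec.
Qed.

Lemma coord_measurable_sphere a c : coord_measurable [set x | `|x - a| = c].
Proof.
rewrite (_ : [set _ | _] = [set x | `|x - a| <= c] `&` [set x | c <= `|x - a|]).
  apply: coord_measurableI; first exact: coord_measurable_norm_le.
  rewrite /coord_measurable -[X in measurable X]setTI; apply: measurable_fun_le => //.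
  exact: measurable_norm_vec.
apply/seteqP; split => x /=; first by move=> ->; rewrite lexx.
by move=> [xc cx]; apply/eqP; rewrite eq_le xc.
Qed.

(** Divided by [|v| + 1], the affine form is 1-Lipschitz, so the criterion for sublevel sets
    applies; adding 1 covers [v = 0]. *)
Lemma dot_le_caratheodory d v c :
  (@hausdorff R V d).-caratheodory [set x | dot v x <= c].
Proof.
have v1 : 0 < `|v| + 1 by rewrite ltr_wpDl.
rewrite (_ : [set _ | _] = [set x | (dot v x - c) / (`|v| + 1) <= 0]).
  apply: (@hausdorff_sublevel_caratheodory R V d
    (fun x => (dot v x - c) / (`|v| + 1))) => x y.
  rewrite -mulrBl opprB addrA subrK -dotBr normrM normfV (gtr0_norm v1).
  rewrite ler_pdivrMr//; apply: le_trans (cauchy_schwarz norm_dot _ _) _.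
  by rewrite mulrC ler_wpM2l// lerDl.
by apply/seteqP; split => x /=; rewrite ler_pdivrMr// mul0r subr_le0.
Qed.

(** Half spaces are Caratheodory measurable, so the coordinates are measurable functions for that
    sigma-algebra, which therefore contains the preimages of all Borel sets of tuples. *)
Lemma coord_measurable_caratheodory d A : coord_measurable A ->
  (@hausdorff R V d).-caratheodory A.
Proof.
move=> mA; pose C := caratheodory_type (@hausdorff R V d).
have mcoord : measurable_fun [set: C] (coord : C -> n.-tuple R).
  apply/measurable_fun_tnthP => i.
  rewrite (_ : _ \o _ = dot (e i)); last by apply/funext => x /=; rewrite tnth_mktuple.
  apply: (measurability (@RGenOInfty.G R)) => [|_ [_ [t ->] <-]].
    exact: RGenOInfty.measurableE.
  rewrite setTI (_ : _ @^-1` _ = ~` [set x | dot (e i) x <= t]).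
    by apply: caratheodory_measurable_setC; exact: dot_le_caratheodory.
  by apply/seteqP; split => x /=; rewrite in_itv/= andbT ltNge => /negP.
have := mcoord (@measurableT _ _) _ mA; rewrite setTI.
rewrite (_ : _ @^-1` _ = A)//; apply/funext => x /=.
by rewrite (coordK e_basis).
Qed.

End measurability_in_coordinates.

(** * Balanced sets have equal areas on the sphere *)

Section sphere_balance.
Context {R : realType} {V : normedModType R} (dot : {dot V for (@idfun R)}).
Hypothesis norm_dot : forall x : V, `|x| ^+ 2 = dot x x.
Context (m : nat) (e : 'I_m.+2 -> V).
Hypothesis e_basis : orthonormal_basis dot e.
Implicit Types x v : V.
Local Notation vec := (vec e).
Local Notation coord := (coord dot e).
Local Notation H := (hausdorff m.+1).
Variables (a : V) (r : R).
Hypothesis r0 : 0 < r.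

Let sphere := [set x | `|x - a| = r].
Let msphere : coord_measurable e sphere := coord_measurable_sphere norm_dot e_basis a r.

(** The area on the sphere, transported to tuples so that its product with [lebesgue_tuple] can be
    formed. *)
Definition sphere_measure (A : set (m.+2.-tuple R)) : \bar R :=
  H (sphere `&` coord @^-1` A).

Let sphere_measure0 : sphere_measure set0 = 0%E.
Proof. by rewrite /sphere_measure preimage_set0 setI0 outer_measure0. Qed.

Let sphere_measure_ge0 A : (0 <= sphere_measure A)%E.
Proof. exact: outer_measure_ge0. Qed.

Let sphere_measure_semi_sigma_additive : semi_sigma_additive sphere_measure.
Proof.
have carath (A : set (m.+2.-tuple R)) : measurable A ->
    H.-caratheodory (sphere `&` coord @^-1` A).
  move=> mA; apply: (coord_measurable_caratheodory norm_dot e_basis).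
  apply: coord_measurableI => //; rewrite /coord_measurable -comp_preimage.
  rewrite (_ : _ \o _ = id) ?preimage_id//.
  by apply/funext => t; exact: (vecK e_basis).
move=> F mF tF mUF.
have := @caratheodory_measure_sigma_additive R V (hausdorff m.+1)
  (fun k => sphere `&` coord @^-1` F k).
rewrite /sphere_measure preimage_bigcup setI_bigcupr; apply.
- by move=> k; exact: carath.
- apply/trivIsetP => /= i j _ _ ij; rewrite setIACA -preimage_setI.
  by move/trivIsetP : tF => /(_ _ _ _ _ ij) ->//; rewrite preimage_set0 setI0.
- by rewrite -setI_bigcupr -preimage_bigcup; exact: carath.
Qed.

Let sphere_measure_lty A : (sphere_measure A < +oo)%E.
Proof.
apply: le_lt_trans (hausdorff_sphere_lty norm_dot a e_basis r0).
by apply: le_outer_measure; exact: subIsetl.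
Qed.

Let isM := isMeasure.Build _ _ _ sphere_measure sphere_measure0
  sphere_measure_ge0 sphere_measure_semi_sigma_additive.
Let mu0 : {measure set (m.+2.-tuple R) -> \bar R} := HB.pack sphere_measure isM.
Let mu0fin : fin_num_fun mu0.
Proof.
by move=> A _; rewrite ge0_fin_numE//; exact: sphere_measure_lty.
Qed.
Let isF := Measure_isFinite.Build _ _ _ (Measure.sort mu0) mu0fin.
Let mu : {finite_measure set (m.+2.-tuple R) -> \bar R} :=
  HB.pack (Measure.sort mu0) isF.

Let muE A : mu (vec @^-1` A `&` vec @^-1` sphere) = H (sphere `&` A).
Proof.
rewrite /mu/= /sphere_measure; congr hausdorff; apply/seteqP.
split => x /=; rewrite (coordK e_basis); first by move=> [? []].
by move=> [? ?].
Qed.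

Lemma reflectZ w (c : R) x : reflect dot w (c *: x) = c *: reflect dot w x.
Proof.
rewrite /reflect dotZr scalerBr scalerA; congr (_ - _ *: _).
by rewrite mulrCA !mulrA.
Qed.

(* The kernel is the indicator of the ball of radius rho around x pushed outwards
   by 2 rho; hence it only sees points y with |y - a| > r, where the volumes of
   the balls are known. *)
Let push (rho : R) x := a + (1 + 2 * rho / r) *: (x - a).

Let kernel (rho : R) : set (m.+2.-tuple R * m.+2.-tuple R) :=
  [set p | sphere (vec p.1) /\ `|vec p.2 - push rho (vec p.1)| <= rho].

Let push_dist rho x : 0 < rho -> sphere x -> `|push rho x - x| = 2 * rho.
Proof.
move=> rho0 xr; rewrite /push scalerDl scale1r addrA (addrC a) subrK addrAC.
rewrite subrr add0r normrZ xr gtr0_norm ?divr_gt0 ?mulr_gt0//.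
by rewrite divfK// gt_eqF.
Qed.

Let push_norm rho x : 0 < rho -> sphere x -> `|push rho x - a| = r + 2 * rho.
Proof.
move=> rho0 xr; rewrite /push addrC addKr normrZ xr gtr0_norm; last first.
  by rewrite addr_gt0// divr_gt0// mulr_gt0.
by rewrite mulrDl mul1r divfK// gt_eqF.
Qed.

(** In coordinates the kernel is cut out by the sphere and a polynomial inequality; squaring that
    inequality requires [0 <= rho], and otherwise the kernel is empty. *)
Let measurable_kernel rho : measurable (kernel rho).
Proof.
have [rho0|rho0] := leP 0 rho; last first.
  rewrite (_ : kernel rho = set0)//; apply/seteqP; split => // -[t y] [/= _].
  by move=> h; have := normr_ge0 (vec y - push rho (vec t)); lra.
pose c i := dot (e i) a.
rewrite (_ : kernel rho = (fst @^-1` (vec @^-1` sphere)) `&` [set p |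
    \sum_i (tnth p.2 i - (c i + (1 + 2 * rho / r) * (tnth p.1 i - c i))) ^+ 2
    <= rho ^+ 2]).
  apply: measurableI; first by rewrite -[X in measurable X]setTI; exact: measurable_fst.
  rewrite -[X in measurable X]setTI; apply: measurable_fun_le => //.
  apply: measurable_sum => i; apply: measurable_funX; apply: measurable_funB.
    by apply: (measurableT_comp (measurable_tnth i)).
  apply: measurable_funD => //; apply: measurable_funM => //.
  apply: measurable_funB => //.
  by apply: (measurableT_comp (measurable_tnth i)).
apply/funext => -[t y]; rewrite /kernel/=; congr (_ /\ _).
rewrite -(ler_pXn2r (_ : 0 < 2)%N) ?nnegrE// (norm_expand norm_dot e_basis).
congr (is_true (_ <= _)); apply: eq_bigr => i _; rewrite /push /c.
by rewrite dotBr dotDr dotZr dotBr !(dot_basis_sum e_basis).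
Qed.

(** The section over a point of the sphere is a ball of radius [rho], whose volume does not depend
    on its centre. *)
Let kernel_xsection rho : 0 < rho -> forall t,
  lebesgue_tuple (xsection (kernel rho) t) =
  ((fine (lebesgue_tuple (tuple_ball (coord 0) rho)))%:E *
   (\1_(vec @^-1` sphere) t)%:E)%E.
Proof.
move=> rho0 t; rewrite indicE; have [/set_mem/= tS|/negP tS] := boolP (t \in _).
  rewrite mule1 fineK; last first.
    by rewrite ge0_fin_numE ?lebesgue_tuple_ge0//; exact: lebesgue_tuple_ball_lty (ltW rho0).
  rewrite -(lebesgue_tuple_ballE (coord (push rho (vec t)))); congr lebesgue_tuple.
  rewrite (tuple_ballE norm_dot e_basis _ (ltW rho0)).
  by apply/seteqP; split => y; [move/xsectionP => -[]|move=> ?; apply/xsectionP; split].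
rewrite mule0 (_ : xsection _ _ = set0) ?measure0//.
by apply/seteqP; split => // y /xsectionP[/= tS' _]; apply: tS; rewrite inE.
Qed.

(** A reflection about [a] exchanging the two points preserves the sphere and commutes with [push],
    so it carries one section to the other. *)
Let kernel_radial rho y y' : `|vec y - a| = `|vec y' - a| ->
  sphere_measure (ysection (kernel rho) y) =
  sphere_measure (ysection (kernel rho) y').
Proof.
move=> yy'.
have sec z : sphere `&` coord @^-1` ysection (kernel rho) z =
    [set x | sphere x /\ `|vec z - push rho x| <= rho].
  apply/seteqP; split => x.
    by move=> [xr /= /ysectionP[_]]; rewrite /= (coordK e_basis).
  by move=> [xr xz]; split => //=; apply/ysectionP; rewrite /kernel/= (coordK e_basis).
rewrite /sphere_measure !sec; pose w := (vec y - a) - (vec y' - a).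
rewrite -[RHS](hausdorff_reflect_at norm_dot _ a w); congr hausdorff.
have gy : vec y' = reflect_at dot a w (vec y).
  by rewrite /reflect_at (reflect_swap norm_dot yy') addrC subrK.
have gp x : push rho (reflect_at dot a w x) = reflect_at dot a w (push rho x).
  rewrite /push /reflect_at; congr (a + _); rewrite [a + _]addrC addrK -reflectZ.
  by rewrite [a + _]addrC addrK.
apply/funext => x /=; rewrite gy gp reflect_at_isometry//.
by rewrite /sphere/= norm_reflect_at.
Qed.

Let kernel_support rho y t : 0 < rho -> kernel rho (t, y) ->
  r < `|vec y - a| <= r + 3 * rho.
Proof.
move=> rho0 [/= tS yt]; have := push_norm rho0 tS.
have := ler_normB (vec y - push rho (vec t)) (vec y - a).
have -> : vec y - push rho (vec t) - (vec y - a) = - (push rho (vec t) - a).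
  by rewrite opprB addrC addrA subrK opprB.
rewrite normrN.
have := ler_normD (vec y - push rho (vec t)) (push rho (vec t) - a).
rewrite addrA subrK; lra.
Qed.

Let kernel_near rho t y : 0 < rho -> kernel rho (t, y) -> `|vec t - vec y| <= 3 * rho.
Proof.
move=> rho0 [/= tS yt]; rewrite distrC; have := push_dist rho0 tS.
have := ler_normD (vec y - push rho (vec t)) (push rho (vec t) - vec t).
rewrite addrA subrK; lra.
Qed.

(** [N delta] stands for the points within [delta] of the walls: away from it, a displacement by at
    most [delta] changes neither membership in [P] nor in [M]. *)
Variables (P M : set V) (N : R -> set V).
Hypotheses (mP : coord_measurable e P) (mM : coord_measurable e M).
Hypotheses (mN : forall delta, coord_measurable e (N delta)).
Hypothesis nearP : forall delta x (z : V), 0 < delta -> `|x - z| <= delta ->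
  P x -> P z \/ N delta x.
Hypothesis nearM : forall delta x (z : V), 0 < delta -> `|x - z| <= delta ->
  M z -> M x \/ N delta x.
Hypothesis balance : forall t r1, r <= t -> r <= r1 ->
  (volume e (disk a t `&` P) + volume e (disk a r1 `&` M) =
   volume e (disk a r1 `&` P) + volume e (disk a t `&` M))%E.
Hypothesis Nlim : forall x, (forall delta, 0 < delta -> N delta x) -> N 0 x.
Hypothesis Nmono : forall delta delta', delta <= delta' -> N delta `<=` N delta'.
Hypothesis N0 : H (sphere `&` N 0) = 0%E.

Let sphere_le_delta delta : 0 < delta ->
  (H (sphere `&` P) <= H (sphere `&` M) + (H (sphere `&` N delta) + H (sphere `&` N delta)))%E.
Proof.
(* Points paired by the kernel are at distance at most [3 * rho], which is to equal [delta]. *)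
move=> delta0; pose rho := delta / 3.
have rho0 : 0 < rho by rewrite divr_gt0.
have rr : r <= r + 3 * rho by rewrite lerDl mulr_ge0// (ltW rho0).
have rhoE : 3 * rho = delta by rewrite /rho mulrC divfK.
(* A half line from [a] represents every distance, so a radial function of [y] becomes the function
   [h] of the distance. *)
pose ray (t : R) := coord (a + t *: e ord0).
pose h : R -> \bar R := (fun t => mu (ysection (kernel rho) (ray t))) \_ `]r, r + 3 * rho].
have ysecE y : mu (ysection (kernel rho) y) = h `|vec y - a|.
  rewrite /h patchE; case: ifPn => [_|ny].
    apply: kernel_radial; rewrite /ray (coordK e_basis) [a + _]addrC addrK normrZ.
    by rewrite (norm_basis norm_dot e_basis) mulr1 normr_id.
  rewrite (_ : ysection _ _ = set0) ?measure0//; apply/seteqP; split => // t /ysectionP.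
  move=> /(kernel_support rho0) ry; move: ny; rewrite notin_setE; apply.
  by rewrite /= in_itv.
rewrite -!muE.
apply: (@kernel_le _ _ _ _ R mu (@lebesgue_tuple R m.+2) (kernel rho)
  (measurable_kernel rho) (vec @^-1` sphere) msphere
  (fine (lebesgue_tuple (tuple_ball (coord 0) rho))) (kernel_xsection rho0) _
  sphere_measure_lty (vec @^-1` P) (vec @^-1` M) (vec @^-1` N delta)
  (vec @^-1` P) (vec @^-1` M)) => //.
- by rewrite fine_gt0// lebesgue_tuple_ball_gt0//=; exact: lebesgue_tuple_ball_lty (ltW rho0).
- exact: mN.
- move=> [t y] [Kty [/= Pt _]]; have := kernel_near rho0 Kty; rewrite rhoE => ty.
  by have [Py|Nt] := nearP delta0 ty Pt; [left|right].
- move=> [t y] [Kty [/= _ My]]; have := kernel_near rho0 Kty; rewrite rhoE => ty.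
  by have [Mt|Nt] := nearM delta0 ty My; [left|right].
have intE D : (\int[@lebesgue_tuple R m.+2]_(y in D) mu (ysection (kernel rho) y) =
    \int[@lebesgue_tuple R m.+2]_(y in D) h (`|vec y - a|)%R)%E.
  by apply: eq_integral => y _; exact: ysecE.
rewrite !intE.
have ballE t : r <= t -> [set y | `|vec y - a| <= t] = tuple_ball (coord a) t.
  by move=> rt; rewrite (tuple_ballE norm_dot e_basis)// (le_trans (ltW r0)).
apply: (@eq_integral_level _ _ R (@lebesgue_tuple R m.+2) (vec @^-1` P) (vec @^-1` M)
  mP mM (fun y => `|vec y - a|) (measurable_norm_vec norm_dot e_basis a)
  r (r + 3 * rho)).
- by rewrite ballE//; apply: lebesgue_tuple_ball_lty; exact: le_trans (ltW r0) rr.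
- move=> t /andP[rt tr1]; have := @balance t (r + 3 * rho) rt (le_trans rt tr1).
  by rewrite /volume !(setIC (disk _ _)).
- have mI : measurable (`]r, r + 3 * rho]%classic : set R) by exact: measurable_itv.
  apply: (measurable_restrictT _ mI).1; apply: measurable_funTS.
  apply: (measurableT_comp (measurable_fun_ysection mu (measurable_kernel rho))).
  apply/measurable_fun_tnthP => i.
  rewrite (_ : _ \o _ = (fun t => dot (e i) a + t * dot (e i) (e ord0))).
    by apply: measurable_funD => //; apply: measurable_funM.
  by apply/funext => t /=; rewrite tnth_mktuple dotDr dotZr.
- by move=> t; rewrite /h patchE; case: ifPn => // _; exact: measure_ge0.
- move=> t rt; rewrite /h patchE; case: ifPn => // /set_mem; rewrite /= in_itv/= => rt'.
  by rewrite rt' in rt.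
Qed.

(** The error sets decrease to a subset of the null set [N 0] as delta runs through [k.+1%:R^-1];
    continuity from above holds because the sphere has finite area. *)
Lemma sphere_le : (H (sphere `&` P) <= H (sphere `&` M))%E.
Proof.
pose F k := vec @^-1` N (k.+1%:R^-1) `&` vec @^-1` sphere.
have mF k : measurable (F k) by apply: measurableI; [exact: mN|exact: msphere].
have F0 : mu (\bigcap_k F k) = 0%E.
  apply/eqP; rewrite eq_le measure_ge0 andbT -N0 -muE.
  apply: le_measure; rewrite ?inE; [exact: bigcapT_measurable|
    by apply: measurableI; [exact: mN|exact: msphere]|].
  move=> y Fy; split; last by have [] := Fy 0%N I.
  apply: Nlim => delta delta0.
  have [Nk _] := Fy (Num.truncn delta^-1) I; apply: Nmono Nk.
  by rewrite invf_ple ?posrE//; apply/ltW; exact: truncnS_gt.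
have cvgF : mu (F k) @[k --> \oo] --> 0%E.
  rewrite -F0; apply: nonincreasing_cvg_mu => //.
  - exact: bigcapT_measurable.
  - move=> i j ij; apply/subsetPset; apply: setSI => y; apply: Nmono.
    by rewrite lef_pV2 ?posrE// ler_nat.
have cvgM : (H (sphere `&` M) + (mu (F k) + mu (F k)))%E @[k --> \oo] -->
    H (sphere `&` M).
  rewrite -[X in _ --> X]adde0; apply: cvgeD => //; last first.
    by rewrite -[X in _ --> X](adde0 0%E); apply: cvgeD.
  - exact: cvg_cst.
  - by rewrite fin_num_adde_defl.
rewrite -(cvg_lim (@ereal_hausdorff R) cvgM).
apply: lime_ge; first by apply/cvg_ex; exists (H (sphere `&` M)).
by apply: nearW => k; rewrite !muE; apply: sphere_le_delta; rewrite invr_gt0.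
Qed.

End sphere_balance.

Lemma measure_fin_partition d (T : measurableType d) (R : realFieldType)
    (nu : {measure set T -> \bar R}) (I : finType) (Q : pred I) (F : I -> set T) :
  (forall i, Q i -> measurable (F i)) ->
  (forall i j x, Q i -> Q j -> F i x -> F j x -> i = j) ->
  nu [set x | exists2 i, Q i & F i x] = (\sum_(i | Q i) nu (F i))%E.
Proof.
move=> mF inj; pose F' i := if Q i then F i else set0.
rewrite big_mkcond (eq_bigr (fun i => nu (F' i))); last first.
  by move=> i _; rewrite /F'; case: ifP; rewrite ?measure0.
rewrite fsbig_seq ?index_enum_uniq// -measure_fin_bigcup.
- congr (nu _); apply/seteqP; split => x.
    by move=> [i Qi Fx]; exists i; rewrite /= ?mem_index_enum// /F' Qi.
  by move=> [i _]; rewrite /F'; case: ifP => // Qi Fx; exists i.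
- exact: finite_seq.
- move=> i j _ _ [x []]; rewrite /F'; case: ifP => // Qi Fi; case: ifP => // Qj Fj.
  exact: inj Fi Fj.
- by move=> i _; rewrite /F'; case: ifP => // /mF.
Qed.

(** * Surface volumes *)

Section balanced_cells.
Context {R : realType} {V : normedModType R} (dot : {dot V for (@idfun R)}).
Hypothesis norm_dot : forall x : V, `|x| ^+ 2 = dot x x.
Context (n : nat) (e : 'I_n -> V).
Hypothesis e_basis : orthonormal_basis dot e.
Implicit Types (x v : V).

Lemma hausdorff_fin_partition d (I : finType) (Q : pred I) (F : I -> set V) :
  (forall i, Q i -> coord_measurable e (F i)) ->
  (forall i j x, Q i -> Q j -> F i x -> F j x -> i = j) ->
  hausdorff d [set x | exists2 i, Q i & F i x] = (\sum_(i | Q i) hausdorff d (F i))%E.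
Proof.
move=> mF inj; pose hh : {outer_measure set V -> \bar R} := @hausdorff R V d.
pose nu : {measure set (caratheodory_type hh) -> \bar R} :=
  (OuterMeasure.sort hh : set (caratheodory_type hh) -> \bar R).
apply: (@measure_fin_partition _ _ _ nu) => // i Qi.
exact: (coord_measurable_caratheodory norm_dot e_basis d (mF i Qi)).
Qed.

Lemma volume_fin_partition (I : finType) (Q : pred I) (F : I -> set V) :
  (forall i, Q i -> coord_measurable e (F i)) ->
  (forall i j x, Q i -> Q j -> F i x -> F j x -> i = j) ->
  volume e [set x | exists2 i, Q i & F i x] = (\sum_(i | Q i) volume e (F i))%E.
Proof.
move=> mF inj; rewrite -(@measure_fin_partition _ _ _ (@lebesgue_tuple R n) _ Q
  (fun i => vec e @^-1` F i))//.
by move=> i j y Qi Qj; exact: inj.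
Qed.

Context (k : nat) (u : 'I_k -> V).
Local Notation cell := (cell dot u).
Local Notation index := {ffun 'I_k -> bool}.
Implicit Types s : index.

Lemma coord_measurable_dot_eq0 v : coord_measurable e [set x | dot v x = 0].
Proof.
rewrite (_ : [set _ | _] = [set x | dot v x <= 0] `&` ~` [set x | 0 > dot v x]).
  apply: coord_measurableI; first exact: coord_measurable_dot_le.
  rewrite (_ : [set x | 0 > dot v x] = [set x | 0 < dot (- v) x]).
    by apply: coord_measurableC; exact: coord_measurable_dot_gt0.
  by apply/seteqP; split => x; rewrite /= dotNl oppr_gt0.
apply/seteqP; split => x /=; first by move=> ->; rewrite ltxx lexx.
by move=> [vx /negP]; rewrite -leNgt => xv; apply/eqP; rewrite eq_le vx.
Qed.

Lemma coord_measurable_cell s : coord_measurable e (cell s).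
Proof.
apply: (@coord_measurable_forall _ _ _ _ _
  (fun i => [set x | 0 < (-1) ^+ s i * dot (u i) x])) => i.
rewrite (_ : [set _ | _] = [set x | 0 < dot ((-1) ^+ s i *: u i) x]).
  exact: coord_measurable_dot_gt0.
by apply/seteqP; split => x; rewrite /= dotZl.
Qed.

Lemma coord_measurable_facet s i : coord_measurable e (facet dot u s i).
Proof.
apply: (@coord_measurableI _ _ _ _ [set x | dot (u i) x = 0]
  [set x | forall j, j != i -> 0 < (-1) ^+ s j * dot (u j) x]).
  exact: coord_measurable_dot_eq0.
apply: (@coord_measurable_forall _ _ _ _ _
  (fun j => [set x | j != i -> 0 < (-1) ^+ s j * dot (u j) x])) => j.
have [_|ji] := eqVneq j i.
  by rewrite (_ : [set _ | _] = setT); [exact: measurableT|apply/seteqP; split].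
rewrite (_ : [set _ | _] = [set x | 0 < dot ((-1) ^+ s j *: u j) x]).
  exact: coord_measurable_dot_gt0.
by apply/seteqP; split => x /=; rewrite dotZl; [move/(_ isT)|move=> ?].
Qed.

Definition cell_parity s : bool := \big[addb/false]_i s i.

Lemma cell_signE s : cell_sign s = (-1) ^+ cell_parity s :> R.
Proof.
rewrite /cell_sign /cell_parity.
by elim/big_rec2 : _ => [|i p b _ ->]; rewrite ?expr0 ?signr_addb.
Qed.

Lemma cell_sign_sum (G : index -> R) :
  \sum_s cell_sign s * G s =
  \sum_(s | ~~ cell_parity s) G s - \sum_(s | cell_parity s) G s.
Proof.
rewrite (bigID cell_parity)/= addrC; congr (_ + _).
  by apply: eq_bigr => s /negbTE sp; rewrite cell_signE sp expr0 mul1r.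
rewrite -sumrN; apply: eq_bigr => s sp.
by rewrite cell_signE sp expr1 mulN1r.
Qed.

(** Finiteness reduces the statement to real numbers. The form without signs or subtraction is the
    one in which [balance] is assumed, for either choice of the parity. *)
Lemma cell_sign_balance b (F G : index -> \bar R) :
  (forall s, F s \is a fin_num) -> (forall s, G s \is a fin_num) ->
  (\sum_s (cell_sign s)%:E * F s = \sum_s (cell_sign s)%:E * G s)%E ->
  (\sum_(s | cell_parity s == b) F s + \sum_(s | cell_parity s == ~~ b) G s =
   \sum_(s | cell_parity s == b) G s + \sum_(s | cell_parity s == ~~ b) F s)%E.
Proof.
move=> Ffin Gfin; pose f s := fine (F s); pose g s := fine (G s).
have -> : F = (fun s => (f s)%:E) by apply/funext => s; rewrite /f fineK.
have -> : G = (fun s => (g s)%:E) by apply/funext => s; rewrite /g fineK.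
have sumE (h : index -> R) :
    (\sum_s (cell_sign s)%:E * (h s)%:E = (\sum_s cell_sign s * h s)%:E)%E.
  by rewrite -sumEFin.
rewrite !sumE !sumEFin -!EFinD !cell_sign_sum => -[fg]; congr EFin.
have evenE (h : index -> R) :
    \sum_(s | cell_parity s == false) h s = \sum_(s | ~~ cell_parity s) h s.
  by apply: eq_bigl => s; case: cell_parity.
have oddE (h : index -> R) :
    \sum_(s | cell_parity s == true) h s = \sum_(s | cell_parity s) h s.
  by apply: eq_bigl => s; case: cell_parity.
by case: b; rewrite /= !evenE !oddE; lra.
Qed.

Definition flip i s : index := [ffun j => if j == i then ~~ s i else s j].

Lemma flipK i : involutive (flip i).
Proof.
move=> s; apply/ffunP => j; rewrite !ffunE eqxx negbK.
by case: eqVneq => // ->.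
Qed.

Lemma cell_sign_flip i s : cell_sign (flip i s) = - cell_sign s :> R.
Proof.
rewrite /cell_sign (bigD1 i)//= [in RHS](bigD1 i)//= ffunE eqxx.
rewrite (eq_bigr (fun j => (-1) ^+ s j)); last first.
  by move=> j ji; rewrite ffunE (negbTE ji).
by case: (s i) => /=; rewrite ?expr0 ?expr1 ?mul1r ?mulN1r ?opprK.
Qed.

Lemma facet_flip i s : facet dot u (flip i s) i = facet dot u s i.
Proof.
apply/seteqP; split => x [ux sx]; split => // j ji; have := sx j ji;
  by rewrite ffunE (negbTE ji).
Qed.

(* Each facet is shared by the two cells on its sides, which have opposite signs. *)
Lemma cell_sign_facet_sum (G : set V -> R) i :
  \sum_s cell_sign s * G (facet dot u s i) = 0.
Proof.
set S := \sum_s _; suff : S = - S by lra.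
rewrite /S [in LHS](reindex_inj (can_inj (flipK i))) -sumrN.
by apply: eq_bigr => s _; rewrite cell_sign_flip facet_flip mulNr.
Qed.

Definition parity_cells (b : bool) : set V :=
  [set x | exists2 s, cell_parity s == b & cell s x].

(** With the factor [|u i|], and for nonzero normals, these are the points within distance [delta]
    of some hyperplane. *)
Definition slab (delta : R) : set V :=
  [set x | exists i, `|dot (u i) x| <= delta * `|u i|].

(** By Cauchy-Schwarz the i-th form changes by at most [delta * |u i|] between [x] and [z], less
    than its absolute value at [x], so its sign is kept. *)
Lemma cell_near delta s x (z : V) : `|x - z| <= delta -> ~ slab delta x ->
  cell s x <-> cell s z.
Proof.
move=> xz nx; have {}nx i : delta * `|u i| < `|dot (u i) x|.
  by rewrite ltNge; apply/negP => ix; apply: nx; exists i.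
have near i : `|dot (u i) x - dot (u i) z| < `|dot (u i) x|.
  apply: le_lt_trans (nx i); rewrite -dotBr.
  apply: le_trans (cauchy_schwarz norm_dot _ _) _.
  by rewrite mulrC ler_wpM2r.
split=> sx i; have := near i; have := sx i; case: (s i);
  rewrite ?expr0 ?expr1 ?mul1r ?mulN1r; rewrite ltr_norml ?oppr_gt0 => h /andP[].
- by rewrite (ltr0_norm h); lra.
- by rewrite (gtr0_norm h); lra.
- by case: (ltrP 0 (dot (u i) x)) => h'; rewrite ?(gtr0_norm h') ?(ler0_norm h'); lra.
- by case: (ltrP 0 (dot (u i) x)) => h'; rewrite ?(gtr0_norm h') ?(ler0_norm h'); lra.
Qed.

End balanced_cells.

(** * Dimension at least two *)

Section balanced_sphere.
Context {R : realType} {V : normedModType R} (dot : {dot V for (@idfun R)}).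
Hypothesis norm_dot : forall x : V, `|x| ^+ 2 = dot x x.
Context (m : nat) (e : 'I_m.+2 -> V).
Hypothesis e_basis : orthonormal_basis dot e.
Implicit Types (x v : V).
Context (k : nat) (u : 'I_k -> V).
Hypothesis u_neq0 : forall i, u i != 0.
Hypothesis u_inj : forall i j, i != j -> hyperplane dot (u i) <> hyperplane dot (u j).
Local Notation cell := (cell dot u).
Local Notation facet := (facet dot u).
Local Notation index := {ffun 'I_k -> bool}.
Implicit Types s : index.
Variables (a : V) (r : R).
Hypothesis r0 : 0 < r.
Local Notation H := (hausdorff m.+1).
Let sphere := [set x : V | `|x - a| = r].

Lemma u_not_parallel i j : i != j -> forall t, u j != t *: u i.
Proof.
move=> ij t; apply/eqP => uj; apply: (u_inj ij); rewrite uj.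
have t0 : t != 0 by apply: contraNneq (u_neq0 j) => t0; rewrite uj t0 scale0r.
apply/funext => x; rewrite /hyperplane/= dotZl; apply/propext; split=> [->|/eqP].
  by rewrite mulr0.
by rewrite mulf_eq0 (negbTE t0)/= => /eqP.
Qed.

Lemma disk_facet_lty s i : (H (disk a r `&` facet s i) < +oo)%E.
Proof.
apply: (hausdorff_hyperplane_lty norm_dot e_basis (u_neq0 i) (k := 0)).
  exact: norm_bounded_sub (@subIsetl _ _ _) (norm_bounded_disk a r).
by move=> x [_ []].
Qed.

(** A boundary point of the cell lies on exactly one hyperplane, hence in one open facet, or on two
    of them, and such points form a null set. *)
Lemma disk_cell_boundaryE s : cell s !=set0 ->
  H (disk a r `&` (closure (cell s) `\` cell s)) =
  (\sum_i H (disk a r `&` facet s i))%E.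
Proof.
move=> s0; set Y := disk a r `&` _.
pose F i := disk a r `&` facet s i.
have mF i : coord_measurable e (F i).
  apply: coord_measurableI; first exact: coord_measurable_norm_le.
  exact: coord_measurable_facet.
have disj i j x : F i x -> F j x -> i = j.
  move=> [_ [ui _]] [_ [_ /(_ i) uj]]; apply/eqP; apply: contraT => /uj.
  by rewrite ui mulr0 ltxx.
pose G (p : 'I_k * 'I_k) := disk a r `&` [set x | p.1 != p.2 /\
  dot (u p.1) x = 0 /\ dot (u p.2) x = 0].
pose Z := [set x | exists2 i, xpredT i & F i x].
have Z_sub : Z `<=` Y.
  move=> x [i _ [xr [ui sx]]]; split => //; split.
    rewrite (closure_cell norm_dot)// => j; have [->|ji] := eqVneq j i.
      by rewrite ui mulr0.
    exact: ltW (sx j ji).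
  by move=> /(_ i); rewrite ui mulr0 ltxx.
have Y_sub : Y `<=` Z `|` \bigcup_p G p.
  move=> x [xr [sx nsx]]; move: sx; rewrite (closure_cell norm_dot)// => sx.
  have [i ui] : exists i, dot (u i) x = 0.
    apply: contrapT => nu; apply: nsx => i; rewrite lt_neqAle sx andbT eq_sym.
    by rewrite mulf_neq0 ?signr_eq0//; apply/eqP => ui; apply: nu; exists i.
  have [[j [ji uj]]|nj] := pselect (exists j, j != i /\ dot (u j) x = 0).
    by right; exists (j, i).
  left; exists i => //; split => //; split => // j ji.
  rewrite lt_neqAle sx andbT eq_sym mulf_neq0 ?signr_eq0//.
  by apply/eqP => uj; apply: nj; exists j.
have G0 : H (\bigcup_p G p) = 0%E.
  apply: (@hausdorff_bigcup0 _ _ _ _ G) => // -[i j].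
  have [->|ij] := eqVneq i j.
    rewrite (_ : G _ = set0) ?outer_measure0//.
    by apply/seteqP; split => // x [_ [/=]]; rewrite eqxx.
  apply: (hausdorff_codim2 norm_dot e_basis (u_neq0 i) (u_not_parallel ij)
    (k := 0) (k' := 0)).
    exact: norm_bounded_sub (@subIsetl _ _ _) (norm_bounded_disk a r).
  by move=> x [_ [_ []]].
have <- : H Z = (\sum_i H (F i))%E.
  by apply: (hausdorff_fin_partition norm_dot e_basis) => [i _|i j x _ _]; [exact: mF|exact: disj].
apply/eqP; rewrite eq_le; apply/andP; split; last exact: le_outer_measure.
apply: le_trans (le_outer_measure H _ _ Y_sub) _.
by apply: le_trans (outer_measureU2 H _ _) _; rewrite /= G0 adde0.
Qed.

Lemma surface_volume_cell s :
  surface_volume m.+2 (disk a r `&` closure (cell s)) =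
  (H (sphere `&` cell s) + \sum_i H (disk a r `&` facet s i))%E.
Proof.
have [s0|/set0P/negP] := pselect (cell s !=set0); last first.
  rewrite negbK => /eqP s0; rewrite s0 closure0 !setI0 /surface_volume.
  rewrite /boundary closure0 set0D !outer_measure0 mule0 add0e big1// => i _.
  rewrite (_ : _ `&` _ = set0) ?outer_measure0//; apply/seteqP; split => // x [_].
  by move=> /(facet_cell norm_dot u_neq0); rewrite s0 => -[].
(* An empty interior leaves at most one point, which is null in positive dimension; both sides are
   then 0, whatever the factor 2. *)
rewrite /surface_volume -[m.+2.-1]/(m.+1); case: asboolP => [int0|_].
  have bE : boundary (disk a r `&` closure (cell s)) `<=` disk a r `&` closure (cell s).
    by rewrite (boundary_disk_cell norm_dot)// => x [[/= xr sx]|[xr [sx _]]];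
      split => //; rewrite /disk/= ?xr//; exact: subset_closure.
  have H0 : H (boundary (disk a r `&` closure (cell s))) = 0%E.
    have [[x Xx]|] := pselect (boundary (disk a r `&` closure (cell s)) !=set0); last first.
      by move=> /set0P/negP; rewrite negbK => /eqP ->; rewrite outer_measure0.
    apply/eqP; rewrite eq_le outer_measure_ge0 andbT -(hausdorff_set1 m x).
    apply: le_outer_measure => y Xy.
    exact: (disk_cell_degenerate norm_dot u_neq0 r0 s0 int0 (bE y Xy) (bE x Xx)).
  rewrite H0 mule0 -disk_cell_boundaryE//.
  move: H0; rewrite (boundary_disk_cell norm_dot)// => H0'.
  suff E B : B `<=` ([set x | `|x - a| = r] `&` cell s) `|`
      (disk a r `&` (closure (cell s) `\` cell s)) -> H B = 0%E.
    by rewrite !E ?adde0.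
  move=> BX; apply/eqP; rewrite eq_le outer_measure_ge0 andbT -H0'.
  exact: le_outer_measure.
rewrite mul1e (boundary_disk_cell norm_dot)// -disk_cell_boundaryE//.
have mcell : H.-caratheodory (cell s).
  apply: (coord_measurable_caratheodory norm_dot e_basis).
  exact: coord_measurable_cell.
(* Cutting the boundary along the measurable set [cell s] separates the spherical part from the part
   in the hyperplanes. *)
rewrite (mcell _); congr (_ + _)%E; congr hausdorff.
  apply/seteqP; split => x; first by move=> [[[xr sx]|[_ [_ nsx]]] sx'].
  by move=> [xr sx]; split => //; left.
apply/seteqP; split => x; first by move=> [[[xr sx]|//] nsx].
by move=> [xr [sx nsx]]; split => //; right.
Qed.

Hypothesis volumes : forall r1 r2, r <= r1 -> r <= r2 ->
  (\sum_s (cell_sign s)%:E * volume e (disk a r1 `&` cell s) =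
   \sum_s (cell_sign s)%:E * volume e (disk a r2 `&` cell s))%E.

Lemma parity_cellsI b (A : set V) : A `&` parity_cells dot u b =
  [set x | exists2 s, cell_parity s == b & (A `&` cell s) x].
Proof.
apply/seteqP; split => x; first by move=> [Ax [s sb sx]]; exists s.
by move=> [s sb [Ax sx]]; split => //; exists s.
Qed.

Lemma volume_disk_lty r1 A : 0 <= r1 -> coord_measurable e A ->
  (volume e (disk a r1 `&` A) < +oo)%E.
Proof.
move=> r10 mA; apply: le_lt_trans (lebesgue_tuple_ball_lty (coord dot e a) r10).
apply: le_measure; rewrite ?inE; [|exact: measurable_tuple_ball|].
  by apply: coord_measurableI => //; exact: coord_measurable_norm_le.
by move=> y [yr _]; rewrite (tuple_ballE norm_dot e_basis).
Qed.

Lemma volume_parity_cells b r1 :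
  volume e (disk a r1 `&` parity_cells dot u b) =
  (\sum_(s | cell_parity s == b) volume e (disk a r1 `&` cell s))%E.
Proof.
rewrite parity_cellsI volume_fin_partition// => [s _|s s' x _ _ [_ sx] [_ s'x]].
  by apply: coord_measurableI; [exact: coord_measurable_norm_le|exact: coord_measurable_cell].
exact: cell_inj sx s'x.
Qed.

Lemma volume_balance b r1 r2 : r <= r1 -> r <= r2 ->
  (volume e (disk a r1 `&` parity_cells dot u b) +
     volume e (disk a r2 `&` parity_cells dot u (~~ b)) =
   volume e (disk a r2 `&` parity_cells dot u b) +
     volume e (disk a r1 `&` parity_cells dot u (~~ b)))%E.
Proof.
move=> rr1 rr2; rewrite !volume_parity_cells.
have fin r3 s : r <= r3 -> volume e (disk a r3 `&` cell s) \is a fin_num.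
  move=> rr3; rewrite ge0_fin_numE; last exact: measure_ge0.
  apply: volume_disk_lty; [exact: le_trans (ltW r0) rr3|exact: coord_measurable_cell].
apply: (cell_sign_balance b (F := fun s => volume e (disk a r1 `&` cell s))
  (G := fun s => volume e (disk a r2 `&` cell s))) => [s|s|].
- exact: fin.
- exact: fin.
- exact: volumes.
Qed.

Lemma coord_measurable_parity_cells b : coord_measurable e (parity_cells dot u b).
Proof.
rewrite (_ : parity_cells dot u b = [set x | exists s, cell_parity s == b /\ cell s x]).
  apply: (@coord_measurable_exists _ _ _ _ _
    (fun s => [set x | cell_parity s == b /\ cell s x])) => s.
  have [_|_] := boolP (cell_parity s == b).
    rewrite (_ : [set _ | _] = cell s); first exact: coord_measurable_cell.
    by apply/seteqP; split => [x []|x].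
  rewrite (_ : [set _ | _] = set0); first exact: measurable0.
  by apply/seteqP; split => [x []|x].
by apply/seteqP; split => x; [move=> [s sb sx]|move=> [s [sb sx]]]; exists s.
Qed.

Let sphere_slab0 : H (sphere `&` slab dot u 0) = 0%E.
Proof.
apply: (@hausdorff_bigcup0 _ _ _ _ (fun i => [set x | `|x - a| = r /\ dot (u i) x = 0])).
  move=> x [xr [i]]; rewrite mul0r normr_le0 => /eqP ui.
  by exists i.
by move=> i; apply: (hausdorff_sphere_hyperplane0 norm_dot a e_basis r0 (u_neq0 i)).
Qed.

Lemma coord_measurable_slab delta : coord_measurable e (slab dot u delta).
Proof.
apply: (@coord_measurable_exists _ _ _ _ _
  (fun i => [set x | `|dot (u i) x| <= delta * `|u i|])) => i.
rewrite (_ : [set _ | _] = [set x | dot (u i) x <= delta * `|u i|] `&`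
    [set x | dot (- u i) x <= delta * `|u i|]).
  by apply: coord_measurableI; exact: coord_measurable_dot_le.
apply/seteqP; split => x /=; rewrite dotNl ler_norml lerNl.
  by move=> /andP[-> ->].
by move=> [-> ->].
Qed.

Let slab_lim x : (forall delta, 0 < delta -> slab dot u delta x) -> slab dot u 0 x.
Proof.
move=> xs; apply: contrapT => nx.
have ux i : 0 < `|dot (u i) x|.
  by rewrite normr_gt0; apply/eqP => ui; apply: nx; exists i; rewrite ui normr0 mul0r.
pose S := \sum_i `|u i| / `|dot (u i) x|.
have S0 : 0 <= S by apply: sumr_ge0 => i _; rewrite divr_ge0.
have [|i] := xs (1 + S)^-1; first by rewrite invr_gt0 ltr_pwDl.
rewrite mulrC ler_pdivlMr ?ltr_pwDl// leNgt => /negP; apply.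
rewrite mulrC -ltr_pdivrMr//; apply: (@le_lt_trans _ _ S); last by rewrite ltrDr.
by rewrite /S (bigD1 i)//= lerDl sumr_ge0// => j _; rewrite divr_ge0.
Qed.

Let slab_mono delta delta' : delta <= delta' -> slab dot u delta `<=` slab dot u delta'.
Proof.
move=> dd x [i xi]; exists i; apply: le_trans xi _; exact: ler_wpM2r.
Qed.

(** Both values of [b] are covered, and together they give the equality of the two areas. *)
Lemma sphere_cells_le b : (H (sphere `&` parity_cells dot u b) <=
  H (sphere `&` parity_cells dot u (~~ b)))%E.
Proof.
have near b' delta x (z : V) : `|x - z| <= delta -> ~ slab dot u delta x ->
    parity_cells dot u b' x <-> parity_cells dot u b' z.
  by move=> xz nx; split => -[s sb sx]; exists s => //;
    have := cell_near norm_dot s xz nx => -[h1 h2]; [exact: h1|exact: h2].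
apply: (sphere_le norm_dot e_basis r0 (N := slab dot u)).
- exact: coord_measurable_parity_cells.
- exact: coord_measurable_parity_cells.
- exact: coord_measurable_slab.
- move=> delta x z _ xz Px; have [nx|nx] := pselect (slab dot u delta x); first by right.
  by left; exact: (near _ _ _ _ xz nx).1.
- move=> delta x z _ xz Pz; have [nx|nx] := pselect (slab dot u delta x); first by right.
  by left; exact: (near _ _ _ _ xz nx).2.
- exact: volume_balance.
- exact: slab_lim.
- exact: slab_mono.
- exact: sphere_slab0.
Qed.

Let sphere_lty A : (H (sphere `&` A) < +oo)%E.
Proof.
apply: le_lt_trans (hausdorff_sphere_lty norm_dot a e_basis r0).
by apply: le_outer_measure; exact: subIsetl.
Qed.

Lemma sphere_cells_sum :
  \sum_s cell_sign s * fine (H (sphere `&` cell s)) = 0.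
Proof.
have fin A : H (sphere `&` A) \is a fin_num.
  by rewrite ge0_fin_numE ?sphere_lty// outer_measure_ge0.
have HE b : fine (H (sphere `&` parity_cells dot u b)) =
    \sum_(s | cell_parity s == b) fine (H (sphere `&` cell s)).
  apply: EFin_inj; rewrite fineK// -sumEFin parity_cellsI.
  rewrite (hausdorff_fin_partition norm_dot e_basis).
  - by apply: eq_bigr => s _; rewrite fineK.
  - move=> s _; apply: coord_measurableI; first exact: coord_measurable_sphere.
    exact: coord_measurable_cell.
  - by move=> s s' x _ _ [_ sx] [_ s'x]; exact: cell_inj sx s'x.
have : fine (H (sphere `&` parity_cells dot u false)) =
    fine (H (sphere `&` parity_cells dot u true)).
  congr fine; apply/eqP; rewrite eq_le.
  by rewrite (sphere_cells_le false) (sphere_cells_le true).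
rewrite !HE cell_sign_sum => h; apply/eqP; rewrite subr_eq0; apply/eqP.
rewrite (eq_bigl (fun s => cell_parity s == false)); last by move=> s; case: cell_parity.
by rewrite h; apply: eq_bigl => s; case: cell_parity.
Qed.

(** All areas are finite, so the sum can be rearranged in the reals: the spherical parts balance,
    and for each hyperplane the facets cancel in pairs. *)
Lemma surface_volume_sum :
  (\sum_s (cell_sign s)%:E *
     surface_volume m.+2 (disk a r `&` closure (cell s)) = 0)%E.
Proof.
pose f s := fine (H (sphere `&` cell s)).
pose g s i := fine (H (disk a r `&` facet s i)).
transitivity ((\sum_s (cell_sign s * f s + \sum_i cell_sign s * g s i))%:E).
  rewrite -sumEFin; apply: eq_bigr => s _; rewrite surface_volume_cell.
  rewrite -mulr_sumr -mulrDr EFinM EFinD -sumEFin; congr (_ * (_ + _))%E.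
    by rewrite fineK// ge0_fin_numE ?sphere_lty// outer_measure_ge0.
  apply: eq_bigr => i _.
  by rewrite fineK// ge0_fin_numE ?disk_facet_lty// outer_measure_ge0.
congr EFin; rewrite big_split/= sphere_cells_sum add0r exchange_big/= big1// => i _.
exact: (cell_sign_facet_sum dot u (fun A => fine (H (disk a r `&` A)))).
Qed.

End balanced_sphere.

(** * Dimension one *)

Section line.
Context {R : realType} {V : normedModType R} (dot : {dot V for (@idfun R)}).
Hypothesis norm_dot : forall x : V, `|x| ^+ 2 = dot x x.
Context (e : 'I_1 -> V).
Hypothesis e_basis : orthonormal_basis dot e.
Implicit Types (x v : V).

Lemma line_expand f x : `|f| = 1 -> x = dot f x *: f.
Proof.
move=> f1; have := norm_expand norm_dot e_basis f; rewrite f1 expr1n big_ord1 => ff.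
have fE : f = dot (e ord0) f *: e ord0 by rewrite {1}(basis_expand e_basis f) big_ord1.
have xE : x = dot (e ord0) x *: e ord0 by rewrite {1}(basis_expand e_basis x) big_ord1.
rewrite (dot_expand e_basis) big_ord1 [LHS]xE [X in _ = _ *: X]fE scalerA.
by congr (_ *: _); rewrite mulrAC -expr2 -ff mul1r.
Qed.

Lemma line_hyperplane v x : v != 0 -> dot v x = 0 -> x = 0.
Proof.
move=> v0 vx; have n0 : `|v| != 0 by rewrite normr_eq0.
rewrite (@line_expand (`|v|^-1 *: v) x); last by rewrite normrZ normfV normr_id mulVf.
by rewrite dotZl vx mulr0 scale0r.
Qed.

(* The two half lines cut intervals with the end point 0 out of the ball; an
   interval reduced to {0} is the degenerate case counted twice. *)
Lemma surface_volume_half_line v a r : v != 0 -> `|a| <= r ->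
  surface_volume 1 (disk a r `&` [set x | 0 <= dot v x]) =
  (2%:E * hausdorff 0 [set 0%R : V])%E.
Proof.
move=> v0 ar; have n0 : 0 < `|v| by rewrite normr_gt0.
pose f := `|v|^-1 *: v.
have f1 : `|f| = 1 by rewrite normrZ normfV normr_id mulVf// gt_eqF.
have ff : dot f f = 1 by rewrite -norm_dot f1 expr1n.
(* The far end of the interval in the coordinate along [f]. The other end of the ball,
   [dot f a - r], is at most 0 because [|a| <= r], so the half line cuts it off at 0. *)
pose b := r + dot f a.
have fa : `|dot f a| <= r.
  by apply: le_trans (cauchy_schwarz norm_dot _ _) _; rewrite f1 mul1r.
have b0 : 0 <= b by move: fa; rewrite ler_norml /b; lra.
have dist x y : `|x - y| = `|dot f x - dot f y|.
  by rewrite -dotBr [in LHS](line_expand (x - y) f1) normrZ f1 mulr1.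
pose X := [set x | 0 <= dot f x <= b].
have -> : disk a r `&` [set x | 0 <= dot v x] = X.
  have vf x : (0 <= dot v x) = (0 <= dot f x).
    by rewrite /f dotZl pmulr_rge0// invr_gt0.
  apply/seteqP; split => x; rewrite /X/disk/= dist ler_norml vf /b.
    by move=> [/andP[_ xa] ->]/=; lra.
  move: fa; rewrite ler_norml => /andP[fa1 fa2] /andP[x0 xb]; split => //.
  by apply/andP; split; lra.
have Xclosed : closed X.
  rewrite (_ : X = [set x | 0 <= dot f x] `&` (dot f : V -> R^o) @^-1` [set z | z <= b]).
    apply: closedI; first exact: closed_dot_ge0.
    by apply: preimage_closed; [move=> x _; exact: dot_continuous|exact: closed_le].
  by apply/seteqP; split => x; [move=> /andP[]|move=> [/= x0 xb]; apply/andP].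
have Xint : X° = [set x | 0 < dot f x < b].
  apply/seteqP; split => x.
    move=> xX; have /andP[x0 xb] := interior_subset xX.
    have [t t0] := nbhs_step f xX; rewrite /X/= dotDr dotZr ff mulr1 => /andP[_ xt].
    have [t' t'0] := nbhs_step (- f) xX; rewrite /X/= dotDr dotZr dotNr ff => /andP[xt' _].
    by apply/andP; split; lra.
  move=> /andP[x0 xb].
  have : nbhs x ([set x | 0 < dot f x] `&` (dot f : V -> R^o) @^-1` [set z | z < b]).
    apply: open_nbhs_nbhs; split => //; apply: openI; first exact: open_dot_gt0.
    by apply: open_comp; [move=> y _; exact: dot_continuous|exact: open_lt].
  by apply: filterS => y [/= /ltW y0 /ltW yb]; apply/andP.
have bf : dot f (b *: f) = b by rewrite [LHS]dotZr ff mulr1.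
have Xbd : boundary X = [set 0; b *: f].
  rewrite /boundary -(closure_id _).1// Xint; apply/seteqP; split => x /=.
    move=> [/andP[x0 xb] nx]; rewrite (line_expand x f1).
    have [x0'|x0'] := eqVneq (dot f x) 0; first by left; rewrite x0' scale0r.
    have [xb'|xb'] := eqVneq (dot f x) b; first by right; rewrite xb'.
    by exfalso; apply: nx; rewrite !lt_neqAle x0 xb xb' eq_sym x0'.
  by move=> [->|->]; rewrite /X/= ?dot0r ?bf ?lexx ?ltxx ?andbF ?b0.
(* A constant map is a contraction, so all points have the same 0-dimensional measure. *)
have pt (x y : V) : (hausdorff 0 [set x] <= hausdorff 0 [set y])%E.
  pose g (_ : V) := x; have <- : g @` [set y] = [set x] by rewrite image_set1.
  by apply: (hausdorff_contract 0 (g := g)) => x' y'; rewrite subrr normr0.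
have ptE (x y : V) : hausdorff 0 [set x] = hausdorff 0 [set y].
  by apply/eqP; rewrite eq_le; apply/andP; split; exact: pt.
rewrite /surface_volume Xbd Xint /=; case: asboolP => [int0|int0].
  have -> : b = 0.
    apply/eqP; rewrite eq_le b0 andbT leNgt; apply/negP => b1.
    suff : (set0 : set V) (b / 2 *: f) by [].
    by rewrite -int0 /= dotZr ff mulr1; apply/andP; split; lra.
  by rewrite scale0r setUid.
have b1 : 0 < b.
  rewrite lt_neqAle b0 andbT eq_sym; apply/eqP => b1; apply: int0.
  by apply/seteqP; split => // x /=; rewrite b1; lra.
rewrite mul1e.
have -> : (2%:E = 1 + 1 :> \bar R)%E by rewrite -EFinD.
rewrite ge0_muleDl// mul1e {2}(ptE 0 (b *: f)).
apply/eqP; rewrite eq_le; apply/andP; split.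
  exact: outer_measureU2 (hausdorff 0) _ _.
apply: (hausdorffU_sep _ b1) => x y -> ->.
by rewrite sub0r normrN normrZ f1 mulr1 ger0_norm.
Qed.

(** Serves to exclude the empty arrangement on a line: its only chamber is the whole line, and the
    length of the ball depends on the radius. *)
Lemma volume_line (a : V) t : 0 <= t -> volume e (disk a t) = (2 * t)%:E.
Proof.
move=> t0; rewrite /volume.
have -> : [set x : 1.-tuple R | disk a t (\sum_i tnth x i *: e i)] =
    tuple_ball (coord dot e a) t by rewrite (tuple_ballE norm_dot e_basis).
rewrite (lebesgue_tuple_ballE _ [tuple 0 | i < 1]).
rewrite -[RHS]/((2 * t) ^+ 1)%:E -(lebesgue_tuple_box 1 t0); congr lebesgue_tuple.
apply/seteqP; split; first exact: tuple_ball_sub_box.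
move=> x xt; rewrite /tuple_ball/= big_ord1 tnth_mktuple subr0.
by rewrite -real_normK ?num_real// ler_pXn2r ?nnegrE//; exact: xt.
Qed.

End line.

(** * Degenerate cases *)

Section small_dimension.
Context {R : realType} {V : normedModType R}.

Lemma surface_volume_set0 n : surface_volume n (set0 : set V) = 0%E.
Proof. by rewrite /surface_volume /boundary closure0 set0D outer_measure0 mule0. Qed.

Lemma surface_volume_point m (a : V) X : X `<=` [set a] -> surface_volume m.+2 X = 0%E.
Proof.
move=> Xa; rewrite /surface_volume (_ : hausdorff _ _ = 0%E) ?mule0//.
apply/eqP; rewrite eq_le outer_measure_ge0 andbT -(hausdorff_set1 m a).
apply: le_outer_measure => x [xX _].
have := closureS Xa xX; rewrite -(closure_id _).1//.
exact: accessible_closed_set1 (hausdorff_accessible (@norm_hausdorff _ _)) _.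
Qed.

Lemma surface_volume_trivial n (X : set V) : (forall x : V, x = 0) -> surface_volume n X = 0%E.
Proof.
move=> V0; have [[x Xx]|] := pselect (X !=set0); last first.
  by move=> /set0P/negP; rewrite negbK => /eqP ->; exact: surface_volume_set0.
have -> : X = setT.
  by apply/seteqP; split => // y _; rewrite (V0 y) -(V0 x).
by rewrite /surface_volume /boundary interiorT setDT outer_measure0 mule0.
Qed.

End small_dimension.

Theorem theorem8p1 (R : realType) (V : normedModType R)
    (dot : {dot V for (@idfun R)})
    (norm_dot : forall x : V, `|x| ^+ 2 = dot x x)
    (n : nat) (e : 'I_n -> V) (e_basis : orthonormal_basis dot e)
    (Hs : set (set V)) (Hs_arr : arrangement dot Hs)
    (T0 : set V) (T0_chamber : chambers Hs T0)
    (a : V)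
    (pizza_const : forall r1 r2 : R, `|a| <= r1 -> `|a| <= r2 ->
      pizza dot Hs T0 e (disk a r1) = pizza dot Hs T0 e (disk a r2))
    (r : R) (ar : `|a| <= r) :
  (\sum_(T \in chambers Hs) (chamber_sign dot Hs T0 T)%:E *
     surface_volume n (disk a r `&` closure T))%E = 0%E.
Proof.
have [k [u [u_neq0 HsE u_inj T0u T0_neq0]]] :=
  arrangement_index norm_dot Hs_arr T0_chamber.
rewrite (fsbig_chambers norm_dot HsE u_inj T0u T0_neq0
  (G := fun T => surface_volume n (disk a r `&` closure T))); last first.
  by rewrite closure0 setI0 surface_volume_set0.
have volumes r1 r2 : `|a| <= r1 -> `|a| <= r2 ->
    (\sum_s (cell_sign s)%:E * volume e (disk a r1 `&` cell dot u s) =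
     \sum_s (cell_sign s)%:E * volume e (disk a r2 `&` cell dot u s))%E.
  move=> ar1 ar2; have := pizza_const r1 r2 ar1 ar2; rewrite /pizza.
  have v0 r3 : volume e (disk a r3 `&` set0) = 0%E.
    by rewrite setI0 /volume -[[set _ | _]]/set0 measure0.
  by rewrite !(fsbig_chambers norm_dot HsE u_inj T0u T0_neq0
    (G := fun T => volume e (disk a _ `&` T)) (v0 _)).
case: n e e_basis {pizza_const} volumes => [|[|m]] e e_basis volumes.
(* In dimension 0 the space is a single point, and boundaries are empty. *)
- rewrite big1// => s _; rewrite surface_volume_trivial ?mule0// => x.
  by rewrite (basis_expand e_basis x) big_ord0.
- case: k u u_neq0 HsE u_inj T0u volumes => [|k] u u_neq0 HsE u_inj T0u volumes.
    (* Without hyperplanes the balls of radii [|a| + 1] and [|a| + 2] would have the same length. *)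
    exfalso; have cellT s : cell dot u s = setT by apply/seteqP; split => // x _ [].
    pose s : {ffun 'I_0 -> bool} := [ffun=> false].
    have sE (F : {ffun 'I_0 -> bool} -> \bar R) : (\sum_s F s = F s)%E.
      rewrite (bigD1 s)//= big1 ?adde0// => s' /eqP[]; by apply/ffunP => -[].
    have := volumes (`|a| + 1) (`|a| + 2); rewrite !sE !cellT !setIT.
    rewrite !(volume_line norm_dot e_basis) ?addr_ge0//.
    rewrite /cell_sign big_ord0 !mul1e lerDl ler01 lerDl ler0n.
    by move=> /(_ isT isT)[]; lra.
  have half s : surface_volume 1 (disk a r `&` closure (cell dot u s)) =
      (2%:E * hausdorff 0 [set 0%R : V])%E.
    pose v := (-1) ^+ s ord0 *: u ord0.
    have v0 : v != 0 by rewrite scaler_eq0 signr_eq0 (negbTE (u_neq0 _)).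
    (* On a line every hyperplane is the origin, and the listed hyperplanes are pairwise
       distinct. *)
    have only (i : 'I_k.+1) : i = ord0.
      apply/eqP; apply: contraT => i0; case: (u_inj _ _ i0).
      by apply/seteqP; split => x /(line_hyperplane norm_dot e_basis (u_neq0 _)) ->;
        rewrite /hyperplane/= dot0r.
    rewrite -(surface_volume_half_line norm_dot e_basis v0 ar) closure_cell//.
      congr (surface_volume _ (_ `&` _)); apply/seteqP; split => x /=.
        by move=> /(_ ord0); rewrite dotZl.
      by rewrite dotZl => vx i; rewrite (only i).
    exists v => i; rewrite (only i) dotZr mulrA -expr2 sqrr_sign mul1r.
    exact: dotxx_gt0.
  have kfin : (2%:E * hausdorff 0 [set 0%R : V])%E \is a fin_num.
    by rewrite fin_numM// ge0_fin_numE ?outer_measure_ge0// hausdorff_set1_lty.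
  under eq_bigr do rewrite half -(fineK kfin) -EFinM.
  rewrite sumEFin; congr EFin.
  (* For a constant function of the facet, the cancellation says that the signs sum to 0. *)
  exact: (cell_sign_facet_sum dot u (fun=> fine (2%:E * hausdorff 0 [set 0%R : V]))%E ord0).
(* In dimension at least two, a ball of radius 0 is a point and has no surface volume. *)
have [r0|r_le0] := ltP 0 r.
  apply: (surface_volume_sum norm_dot e_basis u_neq0 u_inj r0) => r1 r2 rr1 rr2.
  by apply: volumes; [exact: le_trans rr1|exact: le_trans rr2].
rewrite big1// => s _; rewrite (@surface_volume_point _ _ m a) ?mule0//.
move=> x [xr _]; apply/eqP; rewrite -subr_eq0 -normr_le0.
exact: le_trans xr r_le0.
Qed.
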